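(* Let $\Psi$, $m$, $\Psi^m$, $\rho_g^m<\rho_\ell^m$ and $p$ be as in the context, with $m\neq0$. Let $\varepsilon(\rho)=\varepsilon$ be a positive constant, and let $\rho_*\in(\rho_g^m,\rho_\ell^m)$. Then there exists a constant $\varepsilon_0>0$ (not depending on $\varepsilon$ or $\omega$) such that for any $\omega>0$ with $\varepsilon/\omega^2<\varepsilon_0$ there exists a non-constant $\omega$-periodic (in $x$) traveling wave solution $(\rho,\mathbf{m})$ of the one-dimensional Euler-Korteweg equations $$\partial_t\rho+\partial_x \mathbf{m}=0,\qquad \partial_t \mathbf{m}+\partial_x\!\left(\frac{\mathbf{m}^2}{\rho}\right)+\partial_x\big(p(\rho)\big)=\rho\,\partial_x\big(\varepsilon\,\partial_x^2\rho\big)\quad\text{in }\mathbb{R}\times(0,\infty)$$ with phase transition and satisfying $$\frac1\omega\int_0^\omega\rho\,dx=\rho_* .$$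
   Context: Here $\rho>0$ is the density, $\mathbf{m}$ the (scalar) momentum field and $u=\mathbf{m}/\rho$ the velocity. A traveling wave solution with speed $c\in\mathbb{R}$ is a solution of the form $(\rho(x,t),\mathbf m(x,t))=(\bar\rho(x-ct),\bar{\mathbf m}(x-ct))$; it is $\omega$-periodic if the profiles $\bar\rho,\bar{\mathbf m}$ are $\omega$-periodic. Its mass flux is $j=\rho u-\rho c=\mathbf m-\rho c$. There is no phase transition if $j\equiv0$; otherwise there is phase transition. Standing assumptions. The volume specific available energy $\Psi=\Psi(\rho)$ is $C^2$ for $\rho>0$, and the pressure is $p(\rho)=\rho\Psi'(\rho)-\Psi(\rho)$. There are two points $\rho_\ell>\rho_g>0$ such that the graph of $\Psi$ has a bitangent line through $(\rho_g,\Psi(\rho_g))$ and $(\rho_\ell,\Psi(\rho_\ell))$ (a line tangent to the graph at both points), and in some neighborhood of $[\rho_g,\rho_\ell]$ the graph of $\Psi$ lies strictly above this line except at $\rho_g$ and $\rho_\ell$. For a constant $m\in\mathbb{R}$ set $\Psi^m(\rho)=\Psi(\rho)-\frac{m^2}{2\rho}$. The constant $m$ is assumed to be such that $\Psi^m$ has the same property with $\rho_g,\rho_\ell$ replaced by some $0<\rho_g^m<\rho_\ell^m$, i.e. the graph of $\Psi^m$ has a bitangent line at $\rho_g^m$ and $\rho_\ell^m$ and lies strictly above it in a neighborhood of $[\rho_g^m,\rho_\ell^m]$ except at these two points; this holds when $|m|$ is sufficiently small. *)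

(* Defs.v *)
From Stdlib Require Import Reals.
From Coquelicot Require Import Coquelicot.
Open Scope R_scope.

Definition C2_on_positive (Psi : R -> R) : Prop :=
  forall r, 0 < r ->
    ex_derive Psi r /\ ex_derive (Derive Psi) r /\
    continuous (Derive_n Psi 2) r.

Definition pressure (Psi : R -> R) (r : R) : R := r * Derive Psi r - Psi r.

Definition Psi_m (Psi : R -> R) (m r : R) : R := Psi r - m ^ 2 / (2 * r).

(* The line r |-> alpha + beta * r is tangent to the graph of f at a. *)
Definition tangent_line (f : R -> R) (alpha beta a : R) : Prop :=
  f a = alpha + beta * a /\ is_derive f a beta.

(* Energies are only meaningful for positive densities, hence the neighborhood
   U of [a, b] is taken inside (0, +oo). *)
Definition bitangent_below (f : R -> R) (a b : R) : Prop :=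
  exists alpha beta : R,
    tangent_line f alpha beta a /\ tangent_line f alpha beta b /\
    exists U : R -> Prop,
      open U /\
      (forall r, a <= r <= b -> U r) /\
      (forall r, U r -> 0 < r) /\
      (forall r, U r -> r <> a -> r <> b -> alpha + beta * r < f r).

(* Fields are functions of space first, then time. *)
Definition Dx (f : R -> R -> R) (x t : R) : R := Derive (fun y => f y t) x.
Definition Dt (f : R -> R -> R) (x t : R) : R := Derive (fun s => f x s) t.
Definition Dxx (f : R -> R -> R) : R -> R -> R := Dx (Dx f).
Definition ex_Dx (f : R -> R -> R) (x t : R) : Prop :=
  ex_derive (fun y => f y t) x.
Definition ex_Dt (f : R -> R -> R) (x t : R) : Prop :=
  ex_derive (fun s => f x s) t.

(* Classical solution on R x (0, +oo).  Coquelicot's Derive is total, so the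
   existence of every derivative in the equations is required explicitly. *)
Record euler_korteweg_solution (p : R -> R) (eps : R) (rho m : R -> R -> R)
    : Prop := {
  ek_positive : forall x t, 0 < t -> 0 < rho x t;
  ek_derivable : forall x t, 0 < t ->
    ex_Dt rho x t /\ ex_Dt m x t /\ ex_Dx m x t /\
    ex_Dx rho x t /\ ex_Dx (Dx rho) x t /\ ex_Dx (Dxx rho) x t;
  ek_continuous : forall x t, 0 < t ->
    continuity_2d_pt rho x t /\ continuity_2d_pt m x t /\
    continuity_2d_pt (Dt rho) x t /\ continuity_2d_pt (Dt m) x t /\
    continuity_2d_pt (Dx m) x t /\ continuity_2d_pt (Dx rho) x t /\
    continuity_2d_pt (Dxx rho) x t /\ continuity_2d_pt (Dx (Dxx rho)) x t;
  ek_flux_derivable : forall x t, 0 < t ->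
    ex_Dx (fun y s => m y s ^ 2 / rho y s) x t /\
    ex_Dx (fun y s => p (rho y s)) x t;
  ek_mass : forall x t, 0 < t -> Dt rho x t + Dx m x t = 0;
  ek_momentum : forall x t, 0 < t ->
    Dt m x t + Dx (fun y s => m y s ^ 2 / rho y s) x t
      + Dx (fun y s => p (rho y s)) x t
    = rho x t * Dx (fun y s => eps * Dxx rho y s) x t
}.

Definition wave (c : R) (profile : R -> R) (x t : R) : R := profile (x - c * t).

Definition periodic (omega : R) (f : R -> R) : Prop :=
  forall x, f (x + omega) = f x.

Definition constant_pair (f g : R -> R) : Prop :=
  exists a b : R, forall x, f x = a /\ g x = b.

Definition mass_flux (c : R) (rbar mbar : R -> R) (x : R) : R :=
  mbar x - rbar x * c.

Definition phase_transition (c : R) (rbar mbar : R -> R) : Prop :=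
  ~ (forall x, mass_flux c rbar mbar x = 0).

(* Main.v *)
Require Import Defs.
From Stdlib Require Import Reals ZArith Lra Lia Classical FunctionalExtensionality.
From Coquelicot Require Import Coquelicot.
From mathcomp.classical Require filter.
(* [Dx] is also a name of the standard library. *)
Import Defs.
Open Scope R_scope.

(** The wave is taken stationary: with speed 0 the momentum is the constant [m],
    the mass equation is trivial, and the momentum equation divided by the density
    is the derivative of [eps * rho'' = F' rho - c0], where
    [F rho = Psi rho - m ^ 2 / (2 * rho)].  Subtracting from [F] its bitangent line
    gives a double well [W], with [W = 0] at the two wells [a < b] and [W > 0]
    between them.  After rescaling the period to 1 the equation reads
    [kappa * rho'' = W' rho - lambda] with [kappa = eps / omega ^ 2]: it says that
    [rho] is critical, among densities of mean [rho_star], for the Van der Waals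
    energy, the integral over a period of [kappa / 2 * rho' ^ 2 + W rho].

    A critical density is obtained by gradient descent
    ([critical_density_exists]).  The unknown is [q = rho'], and [rho] is
    [rho_star] plus the zero-mean primitive of [q].  When [W] has a Lipschitz
    derivative, a fixed step size makes the energy decrease by a multiple of the
    mean square of the gradient ([energy_descent]), so the gradients tend to 0 in
    mean square.  The energy bounds the mean square of [q], hence the densities
    are uniformly Hoelder continuous of exponent 1/2, and a uniform cluster point
    ([uniform_cluster_point]) solves the integrated equation.

    The constant density has energy [W rho_star > 0], whereas a density close to
    [b] on a suitable fraction of the period and to [a] elsewhere has arbitrarily
    small integrated potential ([two_phase_competitor]), hence energy below
    [W rho_star] as soon as [kappa] is small.  A descent started there cannot
    accumulate at the constant.

    The potential is only controlled near [a, b], so it is first extended by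
    parabolas ([double_well_extension]).  Conservation of
    [kappa / 2 * rho' ^ 2 - W rho + lambda * rho] forces the solution to stay in
    [a, b], where the extension is invisible ([density_between_wells]). *)

(** * Integrals of continuous functions *)

Lemma is_derive_val (f : R -> R) (x l l' : R) :
  is_derive f x l -> l = l' -> is_derive f x l'.
Proof. now intros H <-. Qed.

Lemma continuous_of_derive (f df : R -> R) :
  (forall x, is_derive f x (df x)) -> forall x, continuous f x.
Proof.
  intros H x; apply (ex_derive_continuous f); exists (df x); apply H.
Qed.

Lemma ex_RInt_cont (f : R -> R) (a b : R) :
  (forall x, continuous f x) -> ex_RInt f a b.
Proof. intros Hf; apply (ex_RInt_continuous f); intros z _; apply Hf. Qed.

Lemma cont_plus (f g : R -> R) :
  (forall x, continuous f x) -> (forall x, continuous g x) ->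
  forall x, continuous (fun y => f y + g y) x.
Proof. intros Hf Hg x; apply (continuous_plus f g); auto. Qed.

Lemma cont_minus (f g : R -> R) :
  (forall x, continuous f x) -> (forall x, continuous g x) ->
  forall x, continuous (fun y => f y - g y) x.
Proof. intros Hf Hg x; apply (continuous_minus f g); auto. Qed.

Lemma cont_mult (f g : R -> R) :
  (forall x, continuous f x) -> (forall x, continuous g x) ->
  forall x, continuous (fun y => f y * g y) x.
Proof. intros Hf Hg x; apply (continuous_mult f g); auto. Qed.

Lemma cont_pow2 (f : R -> R) :
  (forall x, continuous f x) -> forall x, continuous (fun y => f y ^ 2) x.
Proof.
  intros Hf x.
  apply continuous_ext with (fun y => f y * f y); [intros; simpl; ring|].
  now apply cont_mult.
Qed.

Lemma cont_comp (g f : R -> R) :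
  (forall x, continuous f x) -> (forall x, continuous g x) ->
  forall x, continuous (fun y => g (f y)) x.
Proof. intros Hf Hg x; apply (continuous_comp f g); auto. Qed.

(* Hypotheses are compared syntactically: a comparison up to conversion would
   unfold integrals. *)
Ltac cont_hyp g :=
  match goal with
  | H : forall x, continuous ?g' x |- _ => constr_eq g g'; exact H
  end.
Ltac cont_step :=
  lazymatch goal with
  | |- forall x, continuous (fun y => @?f y + @?g y) x => apply (cont_plus f g)
  | |- forall x, continuous (fun y => @?f y - @?g y) x => apply (cont_minus f g)
  | |- forall x, continuous (fun y => @?f y * @?g y) x => apply (cont_mult f g)
  | |- forall x, continuous (fun y => (@?f y) ^ 2) x => apply (cont_pow2 f)
  | |- forall x, continuous (fun _ => ?c) x => intro; apply continuous_const
  | |- forall x, continuous (fun y => y) x => intro; apply continuous_id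
  | |- forall x, continuous (fun y => ?g y) x => cont_hyp g
  | |- forall x, continuous (fun y => ?g (@?f y)) x => apply (cont_comp g f)
  | |- forall x, continuous ?g x => cont_hyp g
  end.
(* Coquelicot integrals carry equalities in a structure that unfolds to R. *)
Ltac as_real := match goal with |- @eq _ ?a ?b => change (@eq R a b) end.
Ltac cont := repeat cont_step.

Lemma RInt_add (f g : R -> R) (a b : R) :
  (forall x, continuous f x) -> (forall x, continuous g x) ->
  RInt (fun x => f x + g x) a b = RInt f a b + RInt g a b.
Proof. intros Hf Hg; apply (RInt_plus f g); now apply ex_RInt_cont. Qed.

Lemma RInt_sub (f g : R -> R) (a b : R) :
  (forall x, continuous f x) -> (forall x, continuous g x) ->
  RInt (fun x => f x - g x) a b = RInt f a b - RInt g a b.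
Proof. intros Hf Hg; apply (RInt_minus f g); now apply ex_RInt_cont. Qed.

Lemma RInt_mul_l (c : R) (f : R -> R) (a b : R) :
  (forall x, continuous f x) ->
  RInt (fun x => c * f x) a b = c * RInt f a b.
Proof. intros Hf; apply (RInt_scal f a b c); now apply ex_RInt_cont. Qed.

Lemma RInt_cst (c a b : R) : RInt (fun _ => c) a b = (b - a) * c.
Proof. now rewrite RInt_const. Qed.

Lemma RInt_split (f : R -> R) (a b c : R) :
  (forall x, continuous f x) -> RInt f a c = RInt f a b + RInt f b c.
Proof.
  intros Hf; symmetry; apply (RInt_Chasles f); now apply ex_RInt_cont.
Qed.

Lemma RInt_monotone (f g : R -> R) (a b : R) :
  a <= b -> (forall x, continuous f x) -> (forall x, continuous g x) ->
  (forall x, a <= x <= b -> f x <= g x) -> RInt f a b <= RInt g a b.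
Proof.
  intros Hab Hf Hg H; apply RInt_le; auto using ex_RInt_cont.
  intros x Hx; apply H; lra.
Qed.

Lemma RInt_nonneg (f : R -> R) (a b : R) :
  a <= b -> (forall x, continuous f x) ->
  (forall x, a <= x <= b -> 0 <= f x) -> 0 <= RInt f a b.
Proof.
  intros Hab Hf H; apply RInt_ge_0; auto using ex_RInt_cont.
  intros x Hx; apply H; lra.
Qed.

Lemma RInt_bound (f : R -> R) (M a b : R) :
  a <= b -> (forall x, continuous f x) ->
  (forall x, a <= x <= b -> f x <= M) -> RInt f a b <= (b - a) * M.
Proof.
  intros Hab Hf H; rewrite <- RInt_cst.
  apply RInt_monotone; auto; intro; apply continuous_const.
Qed.

Lemma is_derive_integral (f : R -> R) (a : R) :
  (forall x, continuous f x) ->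
  forall x, is_derive (fun y => RInt f a y) x (f x).
Proof.
  intros Hf x; apply (is_derive_RInt f _ a); [|apply Hf].
  apply filter_forall; intro y; apply (RInt_correct f); now apply ex_RInt_cont.
Qed.

Lemma RInt_of_derive (f df : R -> R) (a b : R) :
  (forall x, is_derive f x (df x)) -> (forall x, continuous df x) ->
  RInt df a b = f b - f a.
Proof.
  intros Hf Hc; apply is_RInt_unique.
  apply (is_RInt_derive f df); auto.
Qed.

(** The Cauchy-Schwarz inequality against the constant function, which is the
    nonnegativity of the integral of the squared deviation from the mean. *)
Lemma RInt_sqr_le (f : R -> R) (a b : R) :
  a <= b -> (forall x, continuous f x) ->
  RInt f a b ^ 2 <= (b - a) * RInt (fun x => f x ^ 2) a b.
Proof.
  intros Hab Hf.
  destruct (Req_dec a b) as [<-|Hne].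
  { rewrite !RInt_point; unfold zero; simpl; lra. }
  set (I := RInt f a b); set (c := I / (b - a)).
  assert (Hc : c * (b - a) = I) by (unfold c; field; lra).
  assert (H : 0 <= RInt (fun x => f x ^ 2 - 2 * c * f x + c ^ 2) a b).
  { apply RInt_nonneg; auto; [cont|].
    intros x _; replace (_ + _) with ((f x - c) ^ 2) by ring; apply pow2_ge_0. }
  rewrite RInt_add, RInt_sub, RInt_mul_l, RInt_cst in H by cont.
  fold I in H.
  assert (H2 := Rmult_le_pos _ _ (Rlt_le 0 (b - a) ltac:(lra)) H).
  replace (I ^ 2) with (2 * (c * (b - a)) * I - (c * (b - a)) ^ 2)
    by (rewrite Hc; ring).
  nra.
Qed.

(** * Periodic functions and zero-mean primitives *)

Lemma RInt_periodic (f : R -> R) :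
  (forall x, continuous f x) -> periodic 1 f ->
  forall x, RInt f x (x + 1) = RInt f 0 1.
Proof.
  intros Hf Hp x.
  assert (E : RInt f 1 (x + 1) = RInt f 0 x).
  { replace (RInt f 1 (x + 1)) with (RInt f (1 * 0 + 1) (1 * x + 1))
      by (f_equal; ring).
    rewrite <- (RInt_comp_lin f 1 1 0 x) by now apply ex_RInt_cont.
    apply RInt_ext; intros y _.
    unfold scal; simpl; unfold mult; simpl.
    rewrite !Rmult_1_l; apply Hp. }
  assert (E1 := RInt_split f 0 x (x + 1) Hf).
  assert (E2 := RInt_split f 0 1 (x + 1) Hf).
  lra.
Qed.

Lemma periodic_INR (f : R -> R) (n : nat) (x : R) :
  periodic 1 f -> f (x + INR n) = f x.
Proof.
  intros Hp; induction n as [|n IH].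
  - simpl; f_equal; ring.
  - rewrite S_INR, <- IH, <- (Hp (x + INR n)); f_equal; ring.
Qed.

(** Every point has a representative in the unit interval, the same for all
    functions of period 1. *)
Lemma periodic_representative (x : R) :
  exists y, 0 <= y <= 1 /\ forall f, periodic 1 f -> f x = f y.
Proof.
  exists (frac_part x); split.
  { destruct (base_fp x); lra. }
  intros f Hp; unfold frac_part.
  destruct (Z_le_gt_dec 0 (Int_part x)) as [Hz|Hz].
  - rewrite <- (periodic_INR f (Z.to_nat (Int_part x))) with (1 := Hp) (x := x - _).
    f_equal; rewrite INR_IZR_INZ, Z2Nat.id by exact Hz; ring.
  - rewrite <- (periodic_INR f (Z.to_nat (- Int_part x)) x Hp).
    f_equal; rewrite INR_IZR_INZ, Z2Nat.id, opp_IZR by lia; ring.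
Qed.

(** The primitive, vanishing at 0, of a function minus its mean over [0, 1]. *)
Definition prim (f : R -> R) (x : R) : R := RInt (fun y => f y - RInt f 0 1) 0 x.

(** The zero-mean primitive: the inverse of differentiation on the zero-mean
    functions of period 1. *)
Definition primitive (f : R -> R) (x : R) : R := prim f x - RInt (prim f) 0 1.

Lemma is_derive_prim (f : R -> R) :
  (forall x, continuous f x) ->
  forall x, is_derive (prim f) x (f x - RInt f 0 1).
Proof.
  intros Hf; apply (is_derive_integral (fun y => f y - RInt f 0 1)); cont.
Qed.

Lemma is_derive_primitive (f : R -> R) :
  (forall x, continuous f x) ->
  forall x, is_derive (primitive f) x (f x - RInt f 0 1).
Proof.
  intros Hf x; unfold primitive.
  auto_derive; [exists (f x - RInt f 0 1); now apply is_derive_prim|].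
  rewrite Rmult_1_l; apply is_derive_unique, is_derive_prim, Hf.
Qed.

Lemma cont_prim (f : R -> R) :
  (forall x, continuous f x) -> forall x, continuous (prim f) x.
Proof. intros Hf; apply (continuous_of_derive _ _ (is_derive_prim f Hf)). Qed.

Lemma cont_primitive (f : R -> R) :
  (forall x, continuous f x) -> forall x, continuous (primitive f) x.
Proof. intros Hf; apply (continuous_of_derive _ _ (is_derive_primitive f Hf)). Qed.

Lemma mean_primitive (f : R -> R) :
  (forall x, continuous f x) -> RInt (primitive f) 0 1 = 0.
Proof.
  intros Hf; assert (Hp := cont_prim f Hf).
  unfold primitive; rewrite RInt_sub, RInt_cst by cont; as_real; ring.
Qed.

Lemma primitive_increment (f : R -> R) (x y : R) :
  (forall x, continuous f x) ->
  primitive f y - primitive f x = RInt (fun z => f z - RInt f 0 1) x y.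
Proof.
  intros Hf; symmetry; apply RInt_of_derive; [now apply is_derive_primitive|cont].
Qed.

Lemma primitive_1 (f : R -> R) :
  (forall x, continuous f x) -> primitive f 1 = primitive f 0.
Proof.
  intros Hf; assert (H := primitive_increment f 0 1 Hf).
  rewrite RInt_sub, RInt_cst in H by cont; lra.
Qed.

Lemma periodic_primitive (f : R -> R) :
  (forall x, continuous f x) -> periodic 1 f -> periodic 1 (primitive f).
Proof.
  intros Hf Hp x.
  assert (H := primitive_increment f x (x + 1) Hf).
  rewrite RInt_sub, RInt_cst, RInt_periodic in H by (auto; cont); lra.
Qed.

(** Integration by parts: on one period the operator is antisymmetric. *)
Lemma primitive_antisym (f g : R -> R) :
  (forall x, continuous f x) -> (forall x, continuous g x) ->
  RInt (fun x => f x * primitive g x) 0 1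
  = - RInt (fun x => primitive f x * g x) 0 1.
Proof.
  intros Hf Hg.
  assert (Pf := cont_primitive f Hf); assert (Pg := cont_primitive g Hg).
  assert (H : RInt (fun x => (f x - RInt f 0 1) * primitive g x
                             + primitive f x * (g x - RInt g 0 1)) 0 1
              = primitive f 1 * primitive g 1 - primitive f 0 * primitive g 0).
  { apply (RInt_of_derive (fun x => primitive f x * primitive g x)); [|cont].
    intro x; apply (is_derive_mult (primitive f) (primitive g));
      [now apply is_derive_primitive..|intros; apply Rmult_comm]. }
  rewrite !primitive_1 in H by auto.
  rewrite (RInt_ext _ (fun x => (f x * primitive g x + primitive f x * g x)
             - (RInt f 0 1 * primitive g x + RInt g 0 1 * primitive f x))) in H
    by (intros; simpl; ring).
  rewrite RInt_sub, !RInt_add, !RInt_mul_l, !mean_primitive in H by cont.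
  lra.
Qed.

Lemma variance_le (f : R -> R) :
  (forall x, continuous f x) ->
  RInt (fun x => (f x - RInt f 0 1) ^ 2) 0 1 <= RInt (fun x => f x ^ 2) 0 1.
Proof.
  intros Hf; set (c := RInt f 0 1).
  rewrite (RInt_ext _ (fun x => f x ^ 2 - 2 * c * f x + c ^ 2))
    by (intros; simpl; ring).
  rewrite RInt_add, RInt_sub, RInt_mul_l, RInt_cst by cont; fold c.
  assert (0 <= c ^ 2) by apply pow2_ge_0; lra.
Qed.

(** Hoelder continuity of exponent 1/2 of a primitive, with a constant that
    depends only on the mean square of the function. *)
Lemma primitive_holder (f : R -> R) (x y : R) :
  (forall x, continuous f x) -> periodic 1 f -> x <= y <= x + 1 ->
  (primitive f y - primitive f x) ^ 2 <= (y - x) * RInt (fun z => f z ^ 2) 0 1.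
Proof.
  intros Hf Hp Hxy; rewrite primitive_increment by auto.
  eapply Rle_trans; [apply RInt_sqr_le; [lra|cont]|].
  apply Rmult_le_compat_l; [lra|].
  eapply Rle_trans; [|apply (variance_le f Hf)].
  rewrite <- (RInt_periodic (fun z => (f z - RInt f 0 1) ^ 2)) with (x := x);
    [|cont|intro z; now rewrite (Hp z)].
  rewrite (RInt_split _ x y (x + 1)) by cont.
  assert (0 <= RInt (fun z => (f z - RInt f 0 1) ^ 2) y (x + 1)).
  { apply RInt_nonneg; [lra|cont|intros; apply pow2_ge_0]. }
  lra.
Qed.

(** A zero-mean function is controlled by its oscillation. *)
Lemma primitive_bound (f : R -> R) (x : R) :
  (forall x, continuous f x) -> periodic 1 f ->
  primitive f x ^ 2 <= RInt (fun z => f z ^ 2) 0 1.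
Proof.
  intros Hf Hp.
  assert (Pc := cont_primitive f Hf).
  destruct (periodic_representative x) as (y & Hy & Ey).
  rewrite (Ey _ (periodic_primitive f Hf Hp)); clear x Ey.
  set (N := RInt (fun z => f z ^ 2) 0 1).
  assert (N0 : 0 <= N) by (apply RInt_nonneg; [lra|cont|intros; apply pow2_ge_0]).
  assert (H : forall z, 0 <= z <= 1 -> (primitive f y - primitive f z) ^ 2 <= N).
  { intros z Hz; destruct (Rle_dec z y) as [Hzy|Hzy].
    - eapply Rle_trans; [apply primitive_holder; auto; lra|]; fold N; nra.
    - replace ((_ - _) ^ 2) with ((primitive f z - primitive f y) ^ 2) by ring.
      eapply Rle_trans; [apply primitive_holder; auto; lra|]; fold N; nra. }
  replace (primitive f y) with (RInt (fun z => primitive f y - primitive f z) 0 1)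
    by (rewrite RInt_sub, RInt_cst, mean_primitive by cont; as_real; ring).
  eapply Rle_trans; [apply RInt_sqr_le; [lra|cont]|].
  rewrite Rminus_0_r, Rmult_1_l.
  eapply Rle_trans; [apply RInt_bound with (M := N); [lra|cont|]|lra].
  exact H.
Qed.

Lemma poincare_primitive (f : R -> R) :
  (forall x, continuous f x) -> periodic 1 f ->
  RInt (fun x => primitive f x ^ 2) 0 1 <= RInt (fun x => f x ^ 2) 0 1.
Proof.
  intros Hf Hp; assert (Pc := cont_primitive f Hf).
  eapply Rle_trans; [apply RInt_bound with (M := RInt (fun x => f x ^ 2) 0 1);
    [lra|cont|]|lra].
  intros; now apply primitive_bound.
Qed.

Lemma primitive_linear (a b : R) (f g : R -> R) (x : R) :
  (forall x, continuous f x) -> (forall x, continuous g x) ->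
  primitive (fun y => a * f y + b * g y) x = a * primitive f x + b * primitive g x.
Proof.
  intros Hf Hg.
  assert (E : forall y, prim (fun y => a * f y + b * g y) y
                        = a * prim f y + b * prim g y).
  { intro y; unfold prim.
    rewrite !RInt_sub, !RInt_add, !RInt_mul_l, !RInt_cst by cont; as_real; ring. }
  assert (Pf := cont_prim f Hf); assert (Pg := cont_prim g Hg).
  unfold primitive; rewrite E.
  rewrite (RInt_ext _ _ _ _ (fun y _ => E y)).
  rewrite RInt_add, !RInt_mul_l by cont; ring.
Qed.

(** * Compactness of equicontinuous periodic sequences *)

(** A nonprincipal ultrafilter on the natural numbers. *)
Record free_ultrafilter (U : (nat -> Prop) -> Prop) : Prop := {
  fu_tail : forall N, U (fun n => (N <= n)%nat);
  fu_and : forall A B : nat -> Prop, U A -> U B -> U (fun n => A n /\ B n);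
  fu_mono : forall A B : nat -> Prop, (forall n, A n -> B n) -> U A -> U B;
  fu_proper : ~ U (fun _ => False);
  fu_ultra : forall A : nat -> Prop, U A \/ U (fun n => ~ A n)
}.

Lemma free_ultrafilter_exists : exists U, free_ultrafilter U.
Proof.
  assert (HF : filter.ProperFilter (T := nat) eventually).
  { constructor.
    - intros [N HN]; exact (HN N (le_n N)).
    - constructor.
      + exists 0%nat; intros; exact I.
      + intros A B [N HN] [N' HN']; exists (N + N')%nat; intros n Hn.
        split; [apply HN|apply HN']; lia.
      + intros A B H [N HN]; exists N; intros n Hn; apply H, HN, Hn. }
  destruct (filter.ultraFilterLemma HF) as (U & HU & Hsub).
  pose proof (filter.ultra_proper (UltraFilter := HU)) as [Hne [_ HI HS]].
  exists U; constructor.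
  - intros N; apply Hsub; exists N; auto.
  - intros A B HA HB; exact (HI A B HA HB).
  - intros A B H HA; exact (HS A B H HA).
  - exact Hne.
  - intros A; exact (filter.in_ultra_setVsetC A HU).
Qed.

Lemma fu_exists (U : (nat -> Prop) -> Prop) (A : nat -> Prop) :
  free_ultrafilter U -> U A -> exists n, A n.
Proof.
  intros HU HA; apply NNPP; intro H; apply (fu_proper U HU).
  apply (fu_mono U HU) with (2 := HA); intros n Hn; apply H; now exists n.
Qed.

Lemma fu_limit (U : (nat -> Prop) -> Prop) (u : nat -> R) (M : R) :
  free_ultrafilter U -> (forall n, Rabs (u n) <= M) ->
  {l : R | forall eta, 0 < eta -> U (fun n => Rabs (u n - l) <= eta)}.
Proof.
  intros HU HM.
  assert (HB : forall n, - M <= u n <= M) by (intro n; apply Rabs_le_between, HM).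
  destruct (completeness (fun r => U (fun n => r <= u n))) as [l [Hub Hlub]].
  - exists M; intros r Hr.
    destruct (fu_exists U _ HU Hr) as [n Hn]; specialize (HB n); lra.
  - exists (- M); apply (fu_mono U HU) with (2 := fu_tail U HU 0%nat).
    intros n _; apply HB.
  - exists l; intros eta Heta.
    assert (H1 : exists r, l - eta < r /\ U (fun n => r <= u n)).
    { apply NNPP; intro H.
      assert (l <= l - eta); [apply Hlub|lra].
      intros r Hr; apply Rnot_lt_le; intro Hlt; apply H; now exists r. }
    destruct H1 as (r & Hr & Ur).
    destruct (fu_ultra U HU (fun n => l + eta <= u n)) as [H2|H2].
    + specialize (Hub _ H2); simpl in Hub; lra.
    + apply (fu_mono U HU) with (2 := fu_and U HU _ _ Ur H2).
      intros n [Ha Hb]; apply Rabs_le_between; lra.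
Qed.

(** A form of the Arzela-Ascoli theorem.  The limit is the pointwise limit
    along a free ultrafilter; equicontinuity makes the convergence uniform,
    because it suffices to control finitely many points of a period. *)
Lemma uniform_cluster_point (f : nat -> R -> R) (M : R) :
  (forall n, periodic 1 (f n)) ->
  (forall n x, Rabs (f n x) <= M) ->
  (forall eta, 0 < eta -> exists delta, 0 < delta /\
     forall n x y, Rabs (y - x) <= delta -> Rabs (f n y - f n x) <= eta) ->
  exists g : R -> R, (forall x, continuous g x) /\ periodic 1 g /\
    forall eta N, 0 < eta ->
      exists n, (N <= n)%nat /\ forall x, Rabs (f n x - g x) <= eta.
Proof.
  intros Hper HM Hequi.
  destruct free_ultrafilter_exists as [U HU].
  set (L x := fu_limit U (fun n => f n x) M HU (fun n => HM n x)).
  set (g x := proj1_sig (L x)).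
  assert (Hg : forall x eta, 0 < eta -> U (fun n => Rabs (f n x - g x) <= eta))
    by (intro x; exact (proj2_sig (L x))).
  clearbody g; clear L.
  assert (Gequi : forall eta, 0 < eta -> exists delta, 0 < delta /\
    (forall n x y, Rabs (y - x) <= delta -> Rabs (f n y - f n x) <= eta) /\
    forall x y, Rabs (y - x) <= delta -> Rabs (g y - g x) <= 3 * eta).
  { intros eta Heta; destruct (Hequi eta Heta) as (d & Hd & H).
    exists d; split; [|split]; auto; intros x y Hxy.
    destruct (fu_exists U _ HU (fu_and U HU _ _ (Hg x eta Heta) (Hg y eta Heta)))
      as (n & H1 & H2).
    specialize (H n x y Hxy).
    apply Rabs_le_between in H, H1, H2; apply Rabs_le_between; lra. }
  assert (Pg : periodic 1 g).
  { intro x; apply cond_eq; intros eta Heta.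
    destruct (fu_exists U _ HU (fu_and U HU _ _ (Hg x (eta / 4) ltac:(lra))
      (Hg (x + 1) (eta / 4) ltac:(lra)))) as (n & H1 & H2).
    rewrite Hper in H2.
    apply Rabs_le_between in H1, H2; apply Rabs_lt_between; lra. }
  exists g; split; [|split]; auto.
  - intros x; apply continuity_pt_filterlim; intros eta Heta.
    destruct (Gequi (eta / 4) ltac:(lra)) as (d & Hd & _ & H).
    exists d; split; auto; intros y [_ Hy]; simpl in *; unfold Rdist in *.
    specialize (H x y ltac:(lra)); lra.
  - intros eta N Heta.
    destruct (Gequi (eta / 5) ltac:(lra)) as (d & Hd & Hf & HgE).
    assert (Hfin : forall k, U (fun n => forall i, (i <= k)%nat ->
              Rabs (f n (INR i * d) - g (INR i * d)) <= eta / 5)).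
    { induction k as [|k IH].
      - apply (fu_mono U HU) with (2 := Hg (INR 0 * d) (eta / 5) ltac:(lra)).
        intros n Hn i Hi; replace i with 0%nat by lia; exact Hn.
      - apply (fu_mono U HU) with
          (2 := fu_and U HU _ _ IH (Hg (INR (S k) * d) (eta / 5) ltac:(lra))).
        intros n [H1 H2] i Hi; destruct (Nat.eq_dec i (S k)) as [->|]; auto.
        apply H1; lia. }
    destruct (nfloor_ex (1 / d)) as [k Hk]; [apply Rlt_le, Rdiv_lt_0_compat; lra|].
    destruct (fu_exists U _ HU (fu_and U HU _ _ (fu_tail U HU N) (Hfin k)))
      as (n & HN & Hn).
    exists n; split; auto; intro x.
    destruct (periodic_representative x) as (y & Hy & Ey).
    rewrite (Ey _ (Hper n)), (Ey _ Pg).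
    destruct (nfloor_ex (y / d)) as [i Hi]; [apply Rdiv_le_0_compat; lra|].
    assert (Hyd : y / d * d = y) by (field; lra).
    assert (Hi2 : (i <= k)%nat).
    { apply INR_le, Rnot_lt_le; intro Hlt; apply INR_lt in Hlt.
      apply le_INR in Hlt; rewrite S_INR in Hlt.
      assert (y / d <= 1 / d)
        by (apply Rmult_le_compat_r; [apply Rlt_le, Rinv_0_lt_compat|]; lra).
      lra. }
    assert (Hclose : Rabs (y - INR i * d) <= d) by (apply Rabs_le_between; nra).
    assert (H1 := Hf n _ _ Hclose); assert (H2 := HgE _ _ Hclose).
    specialize (Hn i Hi2).
    apply Rabs_le_between in H1, H2, Hn; apply Rabs_le_between; lra.
Qed.

(** * Gradient descent for the Van der Waals energy *)

(** Lipschitz continuity with constant [K] on the whole line. *)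
Definition lipschitz (K : R) (w : R -> R) : Prop :=
  forall x y, Rabs (w y - w x) <= K * Rabs (y - x).

Lemma lipschitz_cont (K : R) (w : R -> R) :
  0 < K -> lipschitz K w -> forall x, continuous w x.
Proof.
  intros HK Hw x; apply continuity_pt_filterlim; intros eta Heta.
  exists (eta / K); split; [apply Rdiv_lt_0_compat; lra|].
  intros y [_ Hy]; simpl in *; unfold Rdist in *.
  apply Rle_lt_trans with (1 := Hw x y).
  replace eta with (K * (eta / K)) by (field; lra).
  now apply Rmult_lt_compat_l.
Qed.

(** A potential with Lipschitz derivative stays close to its tangent lines. *)
Lemma tangent_estimate (W w : R -> R) (K : R) :
  (forall r, is_derive W r (w r)) -> lipschitz K w ->
  forall x y, Rabs (W y - W x - w x * (y - x)) <= K * (y - x) ^ 2.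
Proof.
  intros HW Hw x y.
  destruct (MVT_gen W x y w) as (z & Hz & E).
  - intros; apply HW.
  - intros z _; apply continuity_pt_filterlim, (continuous_of_derive W w HW).
  - rewrite E.
    replace (w z * (y - x) - w x * (y - x)) with ((w z - w x) * (y - x)) by ring.
    rewrite Rabs_mult, <- (pow2_abs (y - x)).
    replace (K * Rabs (y - x) ^ 2) with (K * Rabs (y - x) * Rabs (y - x)) by ring.
    apply Rmult_le_compat_r; [apply Rabs_pos|].
    apply Rle_trans with (1 := Hw x z).
    assert (HK : 0 <= K).
    { assert (H := Hw 0 1); assert (H0 := Rabs_pos (w 1 - w 0)).
      rewrite Rminus_0_r, Rabs_R1 in H; lra. }
    apply Rmult_le_compat_l; auto.
    revert Hz; unfold Rmin, Rmax, Rabs.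
    destruct (Rle_dec x y), (Rcase_abs (z - x)), (Rcase_abs (y - x)); lra.
Qed.

(** The energy of the density [rs + primitive q], of mean [rs] and of
    derivative [q] when [q] has zero mean. *)
Definition energy (W : R -> R) (kappa rs : R) (q : R -> R) : R :=
  kappa / 2 * RInt (fun x => q x ^ 2) 0 1
  + RInt (fun x => W (rs + primitive q x)) 0 1.

(** The gradient in mean square of the energy as a function of [q]. *)
Definition gradient (w : R -> R) (kappa rs : R) (q : R -> R) (x : R) : R :=
  kappa * q x - primitive (fun y => w (rs + primitive q y)) x.

Definition descent_step (w : R -> R) (kappa tau rs : R) (q : R -> R) (x : R) : R :=
  q x - tau * gradient w kappa rs q x.

Definition descent (w : R -> R) (kappa tau rs : R) (q0 : R -> R) (n : nat) : R -> R :=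
  Nat.iter n (descent_step w kappa tau rs) q0.

Lemma cont_gradient (w : R -> R) (kappa rs : R) (q : R -> R) :
  (forall x, continuous w x) -> (forall x, continuous q x) ->
  forall x, continuous (gradient w kappa rs q) x.
Proof.
  intros Hw Hq; assert (Pq := cont_primitive q Hq).
  assert (Hc : forall x, continuous (fun y : R => w (rs + primitive q y)) x) by cont.
  assert (Hp := cont_primitive _ Hc).
  unfold gradient; cont.
Qed.

Lemma periodic_gradient (w : R -> R) (kappa rs : R) (q : R -> R) :
  (forall x, continuous w x) -> (forall x, continuous q x) -> periodic 1 q ->
  periodic 1 (gradient w kappa rs q).
Proof.
  intros Hw Hq Hp x; assert (Pq := cont_primitive q Hq).
  assert (Hc : forall x, continuous (fun y : R => w (rs + primitive q y)) x) by cont.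
  unfold gradient; rewrite (Hp x), (periodic_primitive _ Hc); auto.
  intro y; now rewrite (periodic_primitive q Hq Hp).
Qed.

Lemma descent_regular (w : R -> R) (kappa tau rs : R) (q0 : R -> R) (n : nat) :
  (forall x, continuous w x) -> (forall x, continuous q0 x) -> periodic 1 q0 ->
  (forall x, continuous (descent w kappa tau rs q0 n) x) /\
  periodic 1 (descent w kappa tau rs q0 n).
Proof.
  intros Hw Hq Hp; induction n as [|n [IHc IHp]]; [now split|].
  simpl; fold (descent w kappa tau rs q0 n); unfold descent_step; split.
  - assert (Hg := cont_gradient w kappa rs _ Hw IHc); cont.
  - intro x; rewrite IHp, (periodic_gradient w kappa rs _ Hw IHc IHp); auto.
Qed.

(** The energy has a Lipschitz gradient of constant at most [kappa + 2 * K], by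
    the Poincare inequality, so that the step size [/ (kappa + 2 * K)] gives the
    usual decrease. *)
Lemma energy_descent (W w : R -> R) (K kappa rs : R) (q : R -> R) :
  0 < K -> 0 < kappa ->
  (forall r, is_derive W r (w r)) -> lipschitz K w ->
  (forall x, continuous q x) -> periodic 1 q ->
  let tau := / (kappa + 2 * K) in
  energy W kappa rs (descent_step w kappa tau rs q)
  <= energy W kappa rs q
     - tau / 2 * RInt (fun x => gradient w kappa rs q x ^ 2) 0 1.
Proof.
  intros HK Hk HW Hw Hq Hp tau.
  assert (Htau : 0 < tau) by (apply Rinv_0_lt_compat; lra).
  assert (Hwc := lipschitz_cont K w HK Hw).
  assert (HWc := continuous_of_derive W w HW).
  assert (Pq := cont_primitive q Hq).
  assert (Hg := cont_gradient w kappa rs q Hwc Hq).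
  assert (Hgp := periodic_gradient w kappa rs q Hwc Hq Hp).
  assert (Pg := cont_primitive _ Hg).
  assert (Hc : forall x, continuous (fun y : R => w (rs + primitive q y)) x) by cont.
  assert (Pc := cont_primitive _ Hc).
  set (G := gradient w kappa rs q) in *.
  set (h := fun y => w (rs + primitive q y)) in *.
  assert (Estep : forall x, primitive (descent_step w kappa tau rs q) x
                            = primitive q x - tau * primitive G x).
  { intro x.
    replace (descent_step w kappa tau rs q) with (fun y => 1 * q y + (- tau) * G y)
      by (apply functional_extensionality; intro y;
          unfold descent_step; fold G; ring).
    rewrite primitive_linear by auto; ring. }
  set (A := RInt (fun x => G x ^ 2) 0 1).
  assert (EA : A = kappa * RInt (fun x => q x * G x) 0 1
                   + RInt (fun x => h x * primitive G x) 0 1).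
  { rewrite primitive_antisym by auto.
    unfold A.
    rewrite (RInt_ext _ (fun x => kappa * (q x * G x) - primitive h x * G x))
      by (intros; unfold G at 1, gradient; fold G h; simpl; unfold G, gradient;
          fold h; ring).
    rewrite RInt_sub, RInt_mul_l by cont; as_real; ring. }
  assert (HP : RInt (fun x => primitive G x ^ 2) 0 1 <= A)
    by (apply poincare_primitive; auto).
  assert (H1 : RInt (fun x => W (rs + primitive (descent_step w kappa tau rs q) x)) 0 1
    <= RInt (fun x => W (rs + primitive q x)) 0 1
       - tau * RInt (fun x => h x * primitive G x) 0 1
       + K * tau ^ 2 * RInt (fun x => primitive G x ^ 2) 0 1).
  { rewrite (RInt_ext _ (fun x => W (rs + (primitive q x - tau * primitive G x))))
      by (intros; now rewrite Estep).
    apply Rle_trans with (RInt (fun x => W (rs + primitive q x)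
      - tau * (h x * primitive G x) + K * tau ^ 2 * primitive G x ^ 2) 0 1);
      [|apply Req_le; rewrite RInt_add, RInt_sub, !RInt_mul_l by cont; reflexivity].
    apply RInt_monotone; [lra|cont|cont|].
    intros x _.
    assert (T := tangent_estimate W w K HW Hw (rs + primitive q x)
                   (rs + (primitive q x - tau * primitive G x))).
    apply Rabs_le_between in T; unfold h; nra. }
  assert (H2 : RInt (fun x => descent_step w kappa tau rs q x ^ 2) 0 1
    = RInt (fun x => q x ^ 2) 0 1 - 2 * tau * RInt (fun x => q x * G x) 0 1
      + tau ^ 2 * A).
  { rewrite (RInt_ext _ (fun x => q x ^ 2 - 2 * tau * (q x * G x)
                                   + tau ^ 2 * G x ^ 2))
      by (intros; unfold descent_step; fold G; simpl; ring).
    rewrite RInt_add, RInt_sub, !RInt_mul_l by cont; reflexivity. }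
  unfold energy; rewrite H2.
  assert (Etau : tau * (kappa + 2 * K) = 1) by (unfold tau; field; lra).
  assert (H3 : K * tau ^ 2 * RInt (fun x => primitive G x ^ 2) 0 1
               <= K * tau ^ 2 * A).
  { apply Rmult_le_compat_l; auto.
    apply Rmult_le_pos; [lra|apply pow2_ge_0]. }
  assert (H4 : kappa / 2 * (tau ^ 2 * A) + K * tau ^ 2 * A
               = tau / 2 * (tau * (kappa + 2 * K)) * A) by field.
  rewrite Etau in H4.
  assert (H5 : tau * A = tau * (kappa * RInt (fun x => q x * G x) 0 1)
    + tau * RInt (fun x => h x * primitive G x) 0 1) by (rewrite EA at 1; ring).
  lra.
Qed.

(** For a nonnegative potential the energies along the descent converge, hence
    the gradients tend to 0 in mean square. *)
Lemma descent_gradient_small (W w : R -> R) (K kappa rs : R) (q0 : R -> R) :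
  0 < K -> 0 < kappa ->
  (forall r, is_derive W r (w r)) -> lipschitz K w -> (forall r, 0 <= W r) ->
  (forall x, continuous q0 x) -> periodic 1 q0 ->
  let tau := / (kappa + 2 * K) in
  let q n := descent w kappa tau rs q0 n in
  (forall n, energy W kappa rs (q n) <= energy W kappa rs q0) /\
  forall eta, 0 < eta -> exists N, forall n, (N <= n)%nat ->
    RInt (fun x => gradient w kappa rs (q n) x ^ 2) 0 1 <= eta.
Proof.
  intros HK Hk HW Hw Hpos Hq0 Hp0 tau q.
  assert (Hwc := lipschitz_cont K w HK Hw).
  assert (HWc := continuous_of_derive W w HW).
  assert (Htau : 0 < tau) by (apply Rinv_0_lt_compat; lra).
  assert (Hreg := fun n => descent_regular w kappa tau rs q0 n Hwc Hq0 Hp0).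
  assert (Hdec : forall n, energy W kappa rs (q (S n)) <= energy W kappa rs (q n)
     - tau / 2 * RInt (fun x => gradient w kappa rs (q n) x ^ 2) 0 1).
  { intro n; destruct (Hreg n) as [Hc Hp].
    exact (energy_descent W w K kappa rs (q n) HK Hk HW Hw Hc Hp). }
  assert (HG : forall n, 0 <= RInt (fun x => gradient w kappa rs (q n) x ^ 2) 0 1).
  { intro n; destruct (Hreg n) as [Hc Hp].
    assert (Hg := cont_gradient w kappa rs _ Hwc Hc).
    apply RInt_nonneg; [lra|unfold q; cont|intros; apply pow2_ge_0]. }
  assert (Hmon : forall n, energy W kappa rs (q (S n)) <= energy W kappa rs (q n)).
  { intro n; specialize (Hdec n); specialize (HG n); nra. }
  split.
  { induction n as [|n IH]; [apply Rle_refl|].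
    eapply Rle_trans; [apply Hmon|exact IH]. }
  destruct (ex_finite_lim_seq_decr (fun n => energy W kappa rs (q n)) 0 Hmon)
    as [l Hl].
  { intro n; destruct (Hreg n) as [Hc Hp].
    assert (Pc := cont_primitive _ Hc); fold (q n) in Hc, Pc.
    unfold energy; apply Rplus_le_le_0_compat.
    - apply Rmult_le_pos; [lra|apply RInt_nonneg; [lra|cont|]].
      intros; apply pow2_ge_0.
    - apply RInt_nonneg; [lra|cont|]; intros; apply Hpos. }
  intros eta Heta.
  apply is_lim_seq_spec in Hl.
  assert (He : 0 < tau * eta / 4) by (assert (0 < tau * eta) by nra; lra).
  destruct (Hl (mkposreal _ He)) as [N HN]; simpl in HN.
  exists N; intros n Hn.
  assert (A1 := HN n Hn); assert (A2 := HN (S n) ltac:(lia)).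
  apply Rabs_lt_between in A1, A2; specialize (Hdec n).
  apply Rmult_le_reg_l with (tau / 2); lra.
Qed.

Lemma primitive_sub (f g : R -> R) (x : R) :
  (forall x, continuous f x) -> (forall x, continuous g x) ->
  primitive f x - primitive g x = primitive (fun y => f y - g y) x.
Proof.
  intros Hf Hg.
  replace (fun y => f y - g y) with (fun y => 1 * f y + (-1) * g y)
    by (apply functional_extensionality; intro; ring).
  rewrite primitive_linear by auto; ring.
Qed.

(** Starting below the energy [W rs] of the constant density, the descent
    accumulates at a density that is critical for the energy and not constant:
    the bound on the energy gives compactness of the densities, and it passes
    to the limit. *)
Lemma critical_density_exists (W w : R -> R) (K kappa rs : R) (q0 : R -> R) :
  0 < K -> 0 < kappa ->
  (forall r, is_derive W r (w r)) -> lipschitz K w -> (forall r, 0 <= W r) ->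
  (forall x, continuous q0 x) -> periodic 1 q0 ->
  energy W kappa rs q0 < W rs ->
  exists rho : R -> R,
    (forall x, continuous rho x) /\ periodic 1 rho /\
    (exists x, rho x <> rs) /\
    forall x, kappa * (rho x - rs) = primitive (primitive (fun y => w (rho y))) x.
Proof.
  intros HK Hk HW Hw Hpos Hq0 Hp0 HE.
  destruct (descent_gradient_small W w K kappa rs q0 HK Hk HW Hw Hpos Hq0 Hp0)
    as [Hen Hgrad].
  assert (Hwc := lipschitz_cont K w HK Hw).
  assert (HWc := continuous_of_derive W w HW).
  assert (Hreg := fun n =>
    descent_regular w kappa (/ (kappa + 2 * K)) rs q0 n Hwc Hq0 Hp0).
  set (q n := descent w kappa (/ (kappa + 2 * K)) rs q0 n) in *.
  change (forall n, (forall x, continuous (q n) x) /\ periodic 1 (q n)) in Hreg.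
  change (forall n, energy W kappa rs (q n) <= energy W kappa rs q0) in Hen.
  change (forall eta, 0 < eta -> exists N, forall n, (N <= n)%nat ->
    RInt (fun x => gradient w kappa rs (q n) x ^ 2) 0 1 <= eta) in Hgrad.
  clearbody q.
  set (f n x := rs + primitive (q n) x).
  assert (Pq : forall n x, continuous (primitive (q n)) x)
    by (intro n; apply cont_primitive, Hreg).
  assert (Hfc : forall n x, continuous (f n) x).
  { intro n; specialize (Pq n); unfold f; cont. }
  assert (Hfp : forall n, periodic 1 (f n)).
  { intros n x; unfold f; destruct (Hreg n) as [Hc Hp].
    now rewrite (periodic_primitive (q n) Hc Hp). }
  set (C := 2 * W rs / kappa).
  assert (HC : 0 <= C).
  { apply Rdiv_le_0_compat; auto; specialize (Hpos rs); lra. }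
  assert (HqC : forall n, RInt (fun x => q n x ^ 2) 0 1 <= C).
  { intro n; specialize (Hen n); unfold energy at 1 in Hen.
    assert (Hn := Hfc n).
    assert (0 <= RInt (fun x => W (rs + primitive (q n) x)) 0 1).
    { specialize (Pq n); apply RInt_nonneg; [lra|cont|intros; apply Hpos]. }
    apply Rmult_le_reg_l with (kappa / 2); [lra|].
    replace (kappa / 2 * C) with (W rs) by (unfold C; field; lra); lra. }
  destruct (uniform_cluster_point f (Rabs rs + (1 + C))) as (g & Hg & Hgp & Hclose).
  - exact Hfp.
  - intros n x; unfold f; eapply Rle_trans; [apply Rabs_triang|].
    destruct (Hreg n) as [Hc Hp].
    assert (H := primitive_bound (q n) x Hc Hp); specialize (HqC n).
    apply Rplus_le_compat_l, Rabs_le_between; nra.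
  - intros eta Heta; exists (Rmin 1 (eta ^ 2 / (C + 1))).
    assert (H0 : 0 < eta ^ 2 / (C + 1))
      by (apply Rdiv_lt_0_compat; [apply pow_lt|]; lra).
    split; [apply Rmin_pos; lra|].
    assert (HH : forall n x y, x <= y -> Rabs (y - x) <= Rmin 1 (eta ^ 2 / (C + 1)) ->
              Rabs (f n y - f n x) <= eta).
    { intros n x y Hle Hxy; destruct (Hreg n) as [Hc Hp].
      assert (M1 := Rmin_l 1 (eta ^ 2 / (C + 1))).
      assert (M2 := Rmin_r 1 (eta ^ 2 / (C + 1))).
      rewrite Rabs_pos_eq in Hxy by lra.
      assert (H := primitive_holder (q n) x y Hc Hp ltac:(lra)).
      assert (H1 : (y - x) * RInt (fun z => q n z ^ 2) 0 1 <= eta ^ 2).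
      { apply Rle_trans with (eta ^ 2 / (C + 1) * (C + 1)).
        - specialize (HqC n); apply Rmult_le_compat; try lra.
          apply RInt_nonneg; [lra|cont|intros; apply pow2_ge_0].
        - apply Req_le; field; lra. }
      unfold f; replace (rs + primitive (q n) y - (rs + primitive (q n) x))
        with (primitive (q n) y - primitive (q n) x) by ring.
      apply Rabs_le_between; nra. }
    intros n x y Hxy; destruct (Rle_dec x y); [now apply HH|].
    rewrite Rabs_minus_sym; apply HH; [lra|now rewrite Rabs_minus_sym].
  - exists g; split; [|split; [|split]]; auto.
    + apply NNPP; intro Hcst.
      assert (Eg : forall x, g x = rs)
        by (intro x; apply NNPP; intro; apply Hcst; now exists x).
      set (gap := W rs - energy W kappa rs q0).
      (* The density at step n has mean rs, which removes the first order term. *)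
      set (eta := Rmin 1 (gap / (2 * K))).
      assert (Heta : 0 < eta)
        by (apply Rmin_pos; [lra|apply Rdiv_lt_0_compat; unfold gap; lra]).
      destruct (Hclose eta 0%nat Heta) as (n & _ & Hn).
      destruct (Hreg n) as [Hc Hp]; specialize (Hen n); specialize (Hfc n).
      assert (H : RInt (fun x => W rs + w rs * (f n x - rs) - K * eta ^ 2) 0 1
                  <= RInt (fun x => W (f n x)) 0 1).
      { apply RInt_monotone; [lra|cont|cont|]; intros x _.
        assert (T := tangent_estimate W w K HW Hw rs (f n x)).
        specialize (Hn x); rewrite Eg in Hn.
        assert (K * (f n x - rs) ^ 2 <= K * eta ^ 2).
        { apply Rmult_le_compat_l; [lra|]; apply pow_maj_Rabs, Hn. }
        apply Rabs_le_between in T; lra. }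
      rewrite RInt_sub, RInt_add, RInt_mul_l, RInt_sub, !RInt_cst in H by cont.
      assert (E : RInt (f n) 0 1 = rs).
      { specialize (Pq n); unfold f.
        rewrite RInt_add, RInt_cst, mean_primitive by (auto; cont); as_real; ring. }
      rewrite E in H; unfold energy at 1 in Hen.
      change (fun x => W (rs + primitive (q n) x)) with (fun x => W (f n x)) in Hen.
      assert (0 <= RInt (fun x => q n x ^ 2) 0 1)
        by (apply RInt_nonneg; [lra|cont|intros; apply pow2_ge_0]).
      assert (0 <= kappa / 2 * RInt (fun x => q n x ^ 2) 0 1) by nra.
      assert (K * eta ^ 2 <= gap / 2).
      { assert (M1 := Rmin_l 1 (gap / (2 * K))).
        assert (M2 := Rmin_r 1 (gap / (2 * K))); fold eta in M1, M2.
        replace (gap / 2) with (K * (gap / (2 * K))) by (field; lra).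
        apply Rmult_le_compat_l; nra. }
      unfold gap in *; lra.
    + intro x; apply cond_eq; intros e He.
      set (eta := e / (2 * (kappa + 1 + K))).
      assert (Heta : 0 < eta) by (apply Rdiv_lt_0_compat; lra).
      destruct (Hgrad (eta ^ 2)) as [N HN]; [now apply pow_lt|].
      destruct (Hclose eta N Heta) as (n & HNn & Hn).
      specialize (HN n HNn).
      destruct (Hreg n) as [Hc Hp]; specialize (Hfc n); specialize (Hfp n).
      assert (Hgc := cont_gradient w kappa rs (q n) Hwc Hc).
      assert (Hgper := periodic_gradient w kappa rs (q n) Hwc Hc Hp).
      assert (Cf : forall x, continuous (fun y : R => w (f n y)) x) by cont.
      assert (Cg : forall x, continuous (fun y : R => w (g y)) x) by cont.
      assert (PCf := cont_primitive _ Cf); assert (PCg := cont_primitive _ Cg).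
      assert (H1 : Rabs (primitive (gradient w kappa rs (q n)) x) <= eta).
      { assert (H := primitive_bound _ x Hgc Hgper).
        apply Rabs_le_between; nra. }
      assert (E1 : primitive (gradient w kappa rs (q n)) x
        = kappa * (f n x - rs) - primitive (primitive (fun y => w (f n y))) x).
      { replace (gradient w kappa rs (q n))
          with (fun y => kappa * q n y + (-1) * primitive (fun y => w (f n y)) y)
          by (apply functional_extensionality; intro; unfold gradient, f; ring).
        rewrite primitive_linear by auto; unfold f; ring. }
      set (h := fun y => w (f n y) - w (g y)).
      assert (Hh : forall x, continuous h x) by (unfold h; cont).
      assert (Hhp : periodic 1 h) by (intro; unfold h; now rewrite Hfp, Hgp).
      assert (H2 : Rabs (primitive (primitive h) x) <= K * eta).
      { assert (A1 := primitive_bound _ x (cont_primitive h Hh)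
                        (periodic_primitive h Hh Hhp)).
        assert (A2 := poincare_primitive h Hh Hhp).
        assert (A3 : RInt (fun y => h y ^ 2) 0 1 <= (1 - 0) * (K * eta) ^ 2).
        { apply RInt_bound; [lra|cont|]; intros y _.
          apply pow_maj_Rabs; unfold h; rewrite Rabs_minus_sym.
          apply Rle_trans with (1 := Hw (f n y) (g y)).
          rewrite Rabs_minus_sym; apply Rmult_le_compat_l; [lra|apply Hn]. }
        assert (0 < K * eta) by now apply Rmult_lt_0_compat.
        apply Rabs_le_between; nra. }
      assert (E2 : primitive (primitive h) x
        = primitive (primitive (fun y => w (f n y))) x
          - primitive (primitive (fun y => w (g y))) x).
      { rewrite primitive_sub by auto; f_equal.
        apply functional_extensionality; intro y; now rewrite primitive_sub. }
      rewrite E1 in H1; rewrite E2 in H2; specialize (Hn x).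
      apply Rabs_le_between in H1, H2, Hn.
      assert (Ee : e = 2 * (kappa * eta + eta + K * eta))
        by (unfold eta; field; lra).
      assert (0 < K * eta) by now apply Rmult_lt_0_compat.
      assert (0 < kappa * eta) by now apply Rmult_lt_0_compat.
      assert (- (kappa * eta) <= kappa * (f n x - g x) <= kappa * eta) by nra.
      apply Rabs_lt_between; lra.
Qed.

(** * The density stays between the wells *)

Lemma periodic_extrema (f : R -> R) :
  (forall x, continuous f x) -> periodic 1 f ->
  exists u v, forall x, f u <= f x <= f v.
Proof.
  intros Hf Hp.
  assert (Hc : forall c, 0 <= c <= 1 -> continuity_pt f c)
    by (intros; apply continuity_pt_filterlim, Hf).
  destruct (continuity_ab_min f 0 1 ltac:(lra) Hc) as (u & Hu & _).
  destruct (continuity_ab_maj f 0 1 ltac:(lra) Hc) as (v & Hv & _).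
  exists u, v; intro x.
  destruct (periodic_representative x) as (y & Hy & E).
  rewrite (E f Hp); split; [apply Hu|apply Hv]; lra.
Qed.

Lemma derive_zero_at_max (f : R -> R) (v l : R) :
  is_derive f v l -> (forall x, f x <= f v) -> l = 0.
Proof.
  intros Hd Hm; apply is_derive_Reals in Hd.
  assert (pr : derivable_pt f v) by now exists l.
  rewrite <- (deriv_maximum f (v - 1) (v + 1) v pr); try lra; auto.
  symmetry; now apply derive_pt_eq_0.
Qed.

Lemma derive_zero_at_min (f : R -> R) (v l : R) :
  is_derive f v l -> (forall x, f v <= f x) -> l = 0.
Proof.
  intros Hd Hm; apply is_derive_Reals in Hd.
  assert (pr : derivable_pt f v) by now exists l.
  rewrite <- (deriv_minimum f (v - 1) (v + 1) v pr); try lra; auto.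
  symmetry; now apply derive_pt_eq_0.
Qed.

Lemma constant_of_derive_zero (f : R -> R) :
  (forall x, is_derive f x 0) -> forall x y, f x = f y.
Proof.
  intros Hf x y.
  destruct (MVT_gen f x y (fun _ => 0)) as (z & _ & E).
  - intros; apply Hf.
  - intros z _; apply continuity_pt_filterlim.
    apply (continuous_of_derive f (fun _ => 0) Hf).
  - lra.
Qed.

Lemma cont_ivt (f : R -> R) (u v c : R) :
  (forall x, continuous f x) -> f u <= c <= f v -> exists x, f x = c.
Proof.
  intros Hf Hc.
  assert (Hf' : forall x, continuity_pt f x)
    by (intro; apply continuity_pt_filterlim, Hf).
  destruct (IVT_gen f u v c Hf') as (x & _ & E); [|now exists x].
  unfold Rmin, Rmax; destruct (Rle_dec (f u) (f v)); lra.
Qed.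

(** By conservation of [kappa / 2 * drho ^ 2 - W rho + lambda * rho], the graph
    of [W] between the minimum and the maximum of the density lies above its
    chord, of slope [lambda].  If the maximum exceeded the well [b], the chord
    would be increasing (as [W b = 0]) and negative at the minimum; symmetrically
    at [a]. *)
Lemma density_between_wells (W w rho drho : R -> R) (kappa lambda a b : R) :
  0 < kappa ->
  (forall r, is_derive W r (w r)) ->
  (forall x, is_derive rho x (drho x)) ->
  (forall x, is_derive drho x ((w (rho x) - lambda) / kappa)) ->
  periodic 1 rho ->
  W a = 0 -> W b = 0 -> (forall r, 0 <= W r) ->
  (forall r, r < a -> 0 < W r) -> (forall r, b < r -> 0 < W r) ->
  a < RInt rho 0 1 < b ->
  forall x, a <= rho x <= b.
Proof.
  intros Hk HW Hd Hdd Hp Wa Wb Wpos WltA WgtB Hmean.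
  assert (Hc := continuous_of_derive rho drho Hd).
  destruct (periodic_extrema rho Hc Hp) as (u & v & Huv).
  assert (Du := derive_zero_at_min rho u _ (Hd u) (fun x => proj1 (Huv x))).
  assert (Dv := derive_zero_at_max rho v _ (Hd v) (fun x => proj2 (Huv x))).
  assert (Mu : rho u <= RInt rho 0 1).
  { apply Rle_trans with (RInt (fun _ => rho u) 0 1).
    - rewrite RInt_cst; lra.
    - apply RInt_monotone; [lra|cont|cont|intros; apply Huv]. }
  assert (Mv : RInt rho 0 1 <= rho v).
  { eapply Rle_trans; [apply RInt_bound with (M := rho v); [lra|cont|]|lra].
    intros; apply Huv. }
  set (H := fun x => kappa / 2 * drho x ^ 2 - W (rho x) + lambda * rho x).
  assert (Hcst : forall x y, H x = H y).
  { apply constant_of_derive_zero; intro x; unfold H.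
    auto_derive.
    - repeat split; eexists; [apply Hdd|apply HW|apply Hd..].
    - change (fun x0 : R => W x0) with W; change (fun x0 : R => rho x0) with rho.
      change (fun x0 : R => drho x0) with drho.
      rewrite (is_derive_unique _ _ _ (HW (rho x))).
      rewrite (is_derive_unique _ _ _ (Hd x)), (is_derive_unique _ _ _ (Hdd x)).
      field; lra. }
  assert (Hchord : forall r, rho u <= r <= rho v ->
    W (rho u) - lambda * rho u <= W r - lambda * r /\
    W (rho v) - lambda * rho v <= W r - lambda * r).
  { intros r Hr; destruct (cont_ivt rho u v r Hc Hr) as (x & <-).
    assert (Eu := Hcst u x); assert (Ev := Hcst v x).
    unfold H in Eu, Ev; rewrite Du in Eu; rewrite Dv in Ev.
    assert (0 <= kappa / 2 * drho x ^ 2)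
      by (apply Rmult_le_pos; [lra|apply pow2_ge_0]).
    lra. }
  assert (Ha : a <= rho u).
  { apply Rnot_lt_le; intro Hlt.
    destruct (Hchord a ltac:(lra)) as [H1 H2]; rewrite Wa in H1, H2.
    assert (H3 := WltA _ Hlt); assert (H4 := Wpos (rho v)); nra. }
  assert (Hb : rho v <= b).
  { apply Rnot_lt_le; intro Hlt.
    destruct (Hchord b ltac:(lra)) as [H1 H2]; rewrite Wb in H1, H2.
    assert (H3 := WgtB _ Hlt); assert (H4 := Wpos (rho u)); nra. }
  intro x; specialize (Huv x); lra.
Qed.

(** * A competitor of small energy *)

(** The integral of [1 / (1 + k^2 z^2)] tends to 0 as [k] grows, provided that
    [z] does not vanish inside the interval. *)
Lemma lorentzian_small (z : R -> R) (u v eta : R) :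
  u < v -> (forall x, continuous z x) -> (forall x, u < x < v -> z x <> 0) ->
  0 < eta ->
  exists k0, forall k, k0 <= k -> RInt (fun x => / (1 + (k * z x) ^ 2)) u v <= eta.
Proof.
  intros Huv Hz Hnz Heta.
  assert (Hpos : forall k x, 0 < 1 + (k * z x) ^ 2)
    by (intros; assert (0 <= (k * z x) ^ 2) by apply pow2_ge_0; lra).
  assert (Hc : forall k x, continuous (fun x : R => / (1 + (k * z x) ^ 2)) x).
  { intros k x; apply continuous_Rinv_comp; [|now apply Rgt_not_eq, Hpos].
    revert x; cont. }
  (* The end pieces have length d each. *)
  set (d := Rmin ((v - u) / 2) (eta / 3)).
  assert (Hd : 0 < d) by (apply Rmin_pos; lra).
  assert (Hd1 : d <= (v - u) / 2) by apply Rmin_l.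
  assert (Hd2 : d <= eta / 3) by apply Rmin_r.
  destruct (continuity_ab_min (fun x => z x ^ 2) (u + d) (v - d)) as (x0 & Hx0 & Hx0r).
  { lra. }
  { intros x _; apply continuity_pt_filterlim, (cont_pow2 z Hz). }
  set (s := z x0 ^ 2).
  assert (Hs : 0 < s) by (apply pow2_gt_0, Hnz; lra).
  exists (Rmax 1 (3 * (v - u) / (eta * s))); intros k Hk.
  assert (K1 := Rle_trans _ _ _ (Rmax_l _ _) Hk).
  assert (K2 := Rle_trans _ _ _ (Rmax_r _ _) Hk).
  rewrite (RInt_split _ u (u + d) v), (RInt_split _ (u + d) (v - d) v) by auto.
  assert (Hone : forall x, / (1 + (k * z x) ^ 2) <= 1).
  { intro x; apply Rle_trans with (/ 1); [|rewrite Rinv_1; lra].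
    apply Rinv_le_contravar; [lra|].
    assert (0 <= (k * z x) ^ 2) by apply pow2_ge_0; lra. }
  assert (B1 := RInt_bound _ 1 u (u + d) ltac:(lra) (Hc k) (fun x _ => Hone x)).
  assert (B3 := RInt_bound _ 1 (v - d) v ltac:(lra) (Hc k) (fun x _ => Hone x)).
  assert (B2 : RInt (fun x => / (1 + (k * z x) ^ 2)) (u + d) (v - d)
               <= (v - d - (u + d)) * (eta / (3 * (v - u)))).
  { apply RInt_bound; [lra|auto|]; intros x Hx.
    assert (Hzx : s <= z x ^ 2) by (apply Hx0; lra).
    replace (eta / (3 * (v - u))) with (/ (3 * (v - u) / (eta * s) * s))
      by (field; repeat split; lra).
    apply Rinv_le_contravar.
    - apply Rmult_lt_0_compat; auto; apply Rdiv_lt_0_compat; nra.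
    - assert (3 * (v - u) / (eta * s) * s <= k * s) by (apply Rmult_le_compat_r; lra).
      assert (k * s <= k * k * z x ^ 2) by nra.
      replace ((k * z x) ^ 2) with (k * k * z x ^ 2) by ring; lra. }
  assert ((v - d - (u + d)) * (eta / (3 * (v - u))) <= eta / 3).
  { replace (eta / 3) with ((v - u) * (eta / (3 * (v - u)))) by (field; lra).
    apply Rmult_le_compat_r; [|lra].
    apply Rlt_le, Rdiv_lt_0_compat; lra. }
  lra.
Qed.

(** A smooth increasing function with limits -1 and 1. *)
Definition sat (t : R) : R := t / sqrt (1 + t ^ 2).

Lemma sqrt_1_sqr (t : R) :
  0 < sqrt (1 + t ^ 2) /\ sqrt (1 + t ^ 2) * sqrt (1 + t ^ 2) = 1 + t ^ 2.
Proof.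
  assert (0 <= t ^ 2) by apply pow2_ge_0.
  split; [apply sqrt_lt_R0; lra|apply sqrt_sqrt; lra].
Qed.

Lemma is_derive_sat (t : R) :
  is_derive sat t (/ ((1 + t ^ 2) * sqrt (1 + t ^ 2))).
Proof.
  destruct (sqrt_1_sqr t) as [Hr Er].
  assert (0 <= t ^ 2) by apply pow2_ge_0.
  unfold sat; auto_derive.
  - replace (t * (t * 1)) with (t ^ 2) by ring; repeat split; lra.
  - replace (t * (t * 1)) with (t ^ 2) by ring.
    set (r := sqrt (1 + t ^ 2)) in *.
    replace (t ^ 2) with (r * r - 1) by lra.
    replace (1 + (r * r - 1)) with (r * r) by ring.
    apply Rmult_eq_reg_r with (r * r * r); [|apply Rgt_not_eq; nra].
    replace (/ (r * r * r) * (r * r * r)) with 1 by (field; lra).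
    field_simplify; [|lra..].
    replace (t ^ 2) with (r * r - 1) by lra; ring.
Qed.

Lemma sat_bound (t : R) : sat t ^ 2 = 1 - / (1 + t ^ 2).
Proof.
  destruct (sqrt_1_sqr t) as [Hr Er].
  assert (0 <= t ^ 2) by apply pow2_ge_0.
  unfold sat; set (r := sqrt (1 + t ^ 2)) in *.
  replace ((t / r) ^ 2) with (t ^ 2 / (r * r)) by (field; lra).
  rewrite Er; field; lra.
Qed.

Lemma sat_close_1 (t : R) : 0 <= t -> 0 <= 1 - sat t <= / (1 + t ^ 2).
Proof.
  intros Ht; assert (E := sat_bound t); destruct (sqrt_1_sqr t) as [Hr _].
  assert (0 <= sat t) by (apply Rdiv_le_0_compat; auto).
  assert (0 < / (1 + t ^ 2)) by (apply Rinv_0_lt_compat; nra).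
  split; nra.
Qed.

Lemma sat_close_m1 (t : R) : t <= 0 -> 0 <= 1 + sat t <= / (1 + t ^ 2).
Proof.
  intros Ht; assert (H := sat_close_1 (- t) ltac:(lra)).
  unfold sat in *; replace ((- t) ^ 2) with (t ^ 2) in H by ring.
  replace (1 + t / sqrt (1 + t ^ 2)) with (1 - - t / sqrt (1 + t ^ 2))
    by (unfold Rdiv; ring); exact H.
Qed.

(** A function of period 1, positive on (0, theta) and negative on (theta, 1). *)
Definition two_phase (theta x : R) : R := sin (PI * x) * sin (PI * (theta - x)).

Lemma is_derive_two_phase (theta x : R) :
  is_derive (two_phase theta) x (PI * sin (PI * (theta - x) - PI * x)).
Proof.
  unfold two_phase; auto_derive; auto.
  rewrite sin_minus; change (theta + - x) with (theta - x); ring.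
Qed.

Lemma periodic_two_phase (theta : R) : periodic 1 (two_phase theta).
Proof.
  intro x; unfold two_phase.
  replace (PI * (x + 1)) with (PI * x + PI) by ring.
  replace (PI * (theta - x)) with (PI * (theta - (x + 1)) + PI) by ring.
  rewrite !neg_sin; ring.
Qed.

Lemma two_phase_pos (theta x : R) :
  0 < theta < 1 -> 0 < x < theta -> 0 < two_phase theta x.
Proof.
  intros Ht Hx; assert (Hpi := PI_RGT_0).
  apply Rmult_lt_0_compat; apply sin_gt_0; nra.
Qed.

Lemma two_phase_neg (theta x : R) :
  0 < theta < 1 -> theta < x < 1 -> two_phase theta x < 0.
Proof.
  intros Ht Hx; assert (Hpi := PI_RGT_0).
  assert (0 < sin (PI * x)) by (apply sin_gt_0; nra).
  assert (sin (PI * (theta - x)) < 0) by (apply sin_lt_0_var; nra).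
  unfold two_phase; nra.
Qed.

Lemma two_phase_zeros (theta : R) :
  two_phase theta 0 = 0 /\ two_phase theta theta = 0 /\ two_phase theta 1 = 0.
Proof.
  unfold two_phase.
  rewrite Rmult_0_r, sin_0, Rminus_diag, Rmult_0_r, sin_0, Rmult_1_r, sin_PI.
  repeat split; ring.
Qed.

(** A periodic derivative whose primitive has integrated potential as small as
    desired: the density is close to [b] on the fraction of the period which gives
    it the mean [rs], close to [a] elsewhere, with two steep transitions. *)
Lemma two_phase_competitor (W w : R -> R) (K a b rs delta : R) :
  0 < K -> (forall r, is_derive W r (w r)) -> lipschitz K w ->
  W a = 0 -> W b = 0 -> w a = 0 -> w b = 0 ->
  a < rs < b -> 0 < delta ->
  exists q : R -> R, (forall x, continuous q x) /\ periodic 1 q /\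
    RInt (fun x => W (rs + primitive q x)) 0 1 < delta.
Proof.
  intros HK HW Hw Wa Wb wa wb Hrs Hdelta.
  set (D := b - a); set (theta := (rs - a) / D).
  assert (HD : 0 < D) by (unfold D; lra).
  assert (Etheta : theta * D = rs - a) by (unfold theta; field; lra).
  assert (Htheta : 0 < theta < 1) by (unfold D in *; split; nra).
  set (z := two_phase theta).
  assert (Hz := continuous_of_derive z _ (is_derive_two_phase theta)).
  destruct (two_phase_zeros theta) as (Z0 & Zt & Z1); fold z in Z0, Zt, Z1.
  set (eta := Rmin 1 (delta / (2 * K * D ^ 2))).
  assert (HKD : 0 < K * D ^ 2) by (apply Rmult_lt_0_compat; [|apply pow_lt]; lra).
  assert (Heta : 0 < eta) by (apply Rmin_pos; [|apply Rdiv_lt_0_compat]; lra).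
  assert (Heta1 : eta <= 1) by apply Rmin_l.
  assert (Heta2 : K * D ^ 2 * eta < delta).
  { assert (M := Rmin_r 1 (delta / (2 * K * D ^ 2))); fold eta in M.
    apply Rle_lt_trans with (K * D ^ 2 * (delta / (2 * K * D ^ 2))).
    - apply Rmult_le_compat_l; lra.
    - replace (K * D ^ 2 * (delta / (2 * K * D ^ 2))) with (delta / 2)
        by (field; split; lra); lra. }
  destruct (lorentzian_small z 0 theta (eta / 2)) as (k1 & Hk1); try lra; auto.
  { intros x Hx; apply Rgt_not_eq, two_phase_pos; lra. }
  destruct (lorentzian_small z theta 1 (eta / 2)) as (k2 & Hk2); try lra; auto.
  { intros x Hx; apply Rlt_not_eq, two_phase_neg; lra. }
  set (k := Rmax 0 (Rmax k1 k2)).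
  assert (Hk0 : 0 <= k) by apply Rmax_l.
  specialize (Hk1 k (Rle_trans _ _ _ (Rmax_l k1 k2) (Rmax_r 0 _))).
  specialize (Hk2 k (Rle_trans _ _ _ (Rmax_r k1 k2) (Rmax_r 0 _))).
  set (g := fun x => / (1 + (k * z x) ^ 2)) in *.
  assert (Hden : forall x, 1 <= 1 + (k * z x) ^ 2)
    by (intro x; assert (0 <= (k * z x) ^ 2) by apply pow2_ge_0; lra).
  assert (Hg : forall x, continuous g x).
  { intro x; apply continuous_Rinv_comp;
      [revert x; cont|apply Rgt_not_eq; specialize (Hden x); lra]. }
  assert (Hg1 : forall x, 0 <= g x <= 1).
  { intro x; specialize (Hden x); split.
    - apply Rlt_le, Rinv_0_lt_compat; lra.
    - apply Rle_trans with (/ 1); [apply Rinv_le_contravar|rewrite Rinv_1]; lra. }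
  set (phi := fun x => (a + b) / 2 + D / 2 * sat (k * z x)).
  set (q := fun x => D / 2 * (/ ((1 + (k * z x) ^ 2) * sqrt (1 + (k * z x) ^ 2))
                     * (k * (PI * sin (PI * (theta - x) - PI * x))))).
  assert (Hphi : forall x, is_derive phi x (q x)).
  { intro x; unfold phi, q.
    assert (Dz : is_derive (fun y => k * z y) x
                   (k * (PI * sin (PI * (theta - x) - PI * x))))
      by (apply (is_derive_scal z), is_derive_two_phase).
    assert (Ds := is_derive_comp sat (fun y => k * z y) x _ _
                    (is_derive_sat (k * z x)) Dz).
    assert (Dm := is_derive_scal _ x (D / 2) _ Ds).
    assert (Dp := is_derive_plus _ _ x _ _ (is_derive_const ((a + b) / 2) x) Dm).
    eapply is_derive_ext; [|eapply is_derive_val; [exact Dp|]].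
    - intro; reflexivity.
    - unfold plus, zero, scal; simpl; unfold mult; simpl; ring. }
  assert (Hq : forall x, continuous q x).
  { intro x; apply (ex_derive_continuous q); unfold q, z, two_phase.
    assert (Hx := Hden x); unfold z, two_phase in Hx.
    assert (Hs : 0 < sqrt (1 + (k * (sin (PI * x) * sin (PI * (theta - x)))) ^ 2))
      by (apply sqrt_lt_R0; lra).
    auto_derive.
    unfold Rminus in Hx, Hs; simpl in Hx, Hs; repeat split; try lra.
    apply Rgt_not_eq, Rmult_lt_0_compat; lra. }
  assert (Hphip : periodic 1 phi)
    by (intro x; unfold phi, z; now rewrite periodic_two_phase).
  assert (Hqp : periodic 1 q).
  { intro x; unfold q, z; rewrite periodic_two_phase.
    replace (PI * (theta - x) - PI * x)
      with (PI * (theta - (x + 1)) - PI * (x + 1) + 2 * INR 1 * PI)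
      by (simpl; ring).
    now rewrite sin_period. }
  assert (Hphic := continuous_of_derive phi q Hphi).
  set (s := rs - RInt phi 0 1).
  assert (Eprim : forall x, rs + primitive q x = phi x + s).
  { assert (Eq0 : RInt q 0 1 = 0).
    { rewrite (RInt_of_derive phi q) by auto.
      assert (H := Hphip 0); rewrite Rplus_0_l in H; lra. }
    assert (Ediff : forall x y, primitive q x - phi x = primitive q y - phi y).
    { apply constant_of_derive_zero; intro x.
      eapply is_derive_val;
        [apply (is_derive_minus (primitive q) phi x);
          [now apply is_derive_primitive|apply Hphi]|].
      rewrite Eq0; unfold minus, plus, opp; simpl; ring. }
    assert (Emean : RInt (fun x => primitive q x - phi x) 0 1 = primitive q 0 - phi 0).
    { rewrite (RInt_ext _ (fun _ => primitive q 0 - phi 0)) by (intros; apply Ediff).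
      rewrite RInt_cst; as_real; ring. }
    assert (Pq := cont_primitive q Hq).
    rewrite RInt_sub, mean_primitive in Emean by auto.
    intro x; specialize (Ediff x 0); unfold s; lra. }
  assert (Hleft : forall x, 0 <= x <= theta -> 0 <= b - phi x <= D / 2 * g x).
  { intros x Hx.
    assert (Hzx : 0 <= z x).
    { destruct (Req_dec x 0) as [->|]; [lra|].
      destruct (Req_dec x theta) as [->|]; [lra|].
      apply Rlt_le, two_phase_pos; lra. }
    assert (H := sat_close_1 (k * z x) (Rmult_le_pos _ _ Hk0 Hzx)); fold (g x) in H.
    replace (b - phi x) with (D / 2 * (1 - sat (k * z x)))
      by (unfold phi, D; field).
    split; [apply Rmult_le_pos|apply Rmult_le_compat_l]; lra. }
  assert (Hright : forall x, theta <= x <= 1 -> 0 <= phi x - a <= D / 2 * g x).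
  { intros x Hx.
    assert (Hzx : z x <= 0).
    { destruct (Req_dec x 1) as [->|]; [lra|].
      destruct (Req_dec x theta) as [->|]; [lra|].
      apply Rlt_le, two_phase_neg; lra. }
    assert (H := sat_close_m1 (k * z x) ltac:(nra)); fold (g x) in H.
    replace (phi x - a) with (D / 2 * (1 + sat (k * z x)))
      by (unfold phi, D; field).
    split; [apply Rmult_le_pos|apply Rmult_le_compat_l]; lra. }
  assert (Hs : - (D / 2 * eta) <= s <= D / 2 * eta).
  { assert (A1 : 0 <= RInt (fun x => b - phi x) 0 theta)
      by (apply RInt_nonneg; [lra|cont|intros; now apply Hleft]).
    assert (A2 : RInt (fun x => b - phi x) 0 theta <= RInt (fun x => D / 2 * g x) 0 theta)
      by (apply RInt_monotone; [lra|cont|cont|intros; now apply Hleft]).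
    assert (A3 : 0 <= RInt (fun x => phi x - a) theta 1)
      by (apply RInt_nonneg; [lra|cont|intros; now apply Hright]).
    assert (A4 : RInt (fun x => phi x - a) theta 1 <= RInt (fun x => D / 2 * g x) theta 1)
      by (apply RInt_monotone; [lra|cont|cont|intros; now apply Hright]).
    rewrite RInt_sub, RInt_cst in A1, A2, A3, A4 by cont.
    rewrite RInt_mul_l in A2, A4 by cont.
    assert (E := RInt_split phi 0 theta 1 Hphic).
    assert (B1 : D / 2 * RInt g 0 theta <= D / 2 * (eta / 2))
      by (apply Rmult_le_compat_l; lra).
    assert (B2 : D / 2 * RInt g theta 1 <= D / 2 * (eta / 2))
      by (apply Rmult_le_compat_l; lra).
    assert (E2 : rs = theta * b + (1 - theta) * a) by (unfold D in Etheta; lra).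
    unfold s; lra. }
  assert (Hs2 : s ^ 2 <= D ^ 2 / 4 * eta).
  { assert (0 < D / 2 * eta) by nra.
    assert (s ^ 2 <= (D / 2 * eta) ^ 2) by (apply pow_maj_Rabs, Rabs_le_between, Hs).
    assert ((D / 2 * eta) ^ 2 = D ^ 2 / 4 * eta * eta) by field.
    assert (0 <= D ^ 2 / 4 * eta) by nra.
    nra. }
  exists q; split; [|split]; auto.
  apply Rle_lt_trans with (2 := Heta2).
  rewrite (RInt_ext _ (fun x => W (phi x + s))) by (intros; now rewrite Eprim).
  assert (HWc := continuous_of_derive W w HW).
  apply Rle_trans with (RInt (fun x => K * (D ^ 2 / 2) * g x + K * (2 * s ^ 2)) 0 1).
  - apply RInt_monotone; [lra|cont|cont|].
    intros x Hx.
    assert (Hwell : exists c, W c = 0 /\ w c = 0 /\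
              - (D / 2 * g x) <= phi x - c <= D / 2 * g x).
    { destruct (Rle_dec x theta).
      - exists b; repeat split; auto; specialize (Hleft x ltac:(lra)); lra.
      - exists a; repeat split; auto; specialize (Hright x ltac:(lra)); lra. }
    destruct Hwell as (c & Wc & wc & Hc).
    assert (T := tangent_estimate W w K HW Hw c (phi x + s)).
    rewrite Wc, wc, Rmult_0_l, !Rminus_0_r in T; apply Rabs_le_between in T.
    assert (Q : (phi x - c) ^ 2 <= (D / 2 * g x) ^ 2)
      by now apply pow_maj_Rabs, Rabs_le_between.
    assert (Q2 : (D / 2 * g x) ^ 2 <= D ^ 2 / 4 * g x).
    { replace ((D / 2 * g x) ^ 2) with (D ^ 2 / 4 * (g x * g x)) by field.
      specialize (Hg1 x); apply Rmult_le_compat_l; nra. }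
    assert (Q3 : (phi x + s - c) ^ 2 <= 2 * (phi x - c) ^ 2 + 2 * s ^ 2)
      by (assert (0 <= (phi x - c - s) ^ 2) by apply pow2_ge_0; lra).
    assert (K * (phi x + s - c) ^ 2 <= K * (D ^ 2 / 2 * g x + 2 * s ^ 2))
      by (apply Rmult_le_compat_l; lra).
    lra.
  - rewrite RInt_add, RInt_mul_l, RInt_cst by cont.
    rewrite (RInt_split g 0 theta 1) by auto.
    assert (K * (D ^ 2 / 2) * (RInt g 0 theta + RInt g theta 1)
            <= K * (D ^ 2 / 2) * eta) by (apply Rmult_le_compat_l; lra).
    assert (K * (2 * s ^ 2) <= K * (2 * (D ^ 2 / 4 * eta)))
      by (apply Rmult_le_compat_l; lra).
    lra.
Qed.

(** * Periodic equilibria for a globally defined double well *)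

(** For a double well of Lipschitz derivative defined on the whole line, every
    mean strictly between the wells is realized by a nonconstant equilibrium of
    period 1, provided that the capillarity [kappa] is small enough. *)
Theorem periodic_equilibrium_exists (W w : R -> R) (K a b rs : R) :
  0 < K -> (forall r, is_derive W r (w r)) -> lipschitz K w ->
  W a = 0 -> W b = 0 -> w a = 0 -> w b = 0 -> (forall r, 0 <= W r) ->
  (forall r, r < a -> 0 < W r) -> (forall r, b < r -> 0 < W r) ->
  a < rs < b -> 0 < W rs ->
  exists kappa0, 0 < kappa0 /\ forall kappa, 0 < kappa < kappa0 ->
    exists (rho drho : R -> R) (lambda : R),
      (forall x, is_derive rho x (drho x)) /\
      (forall x, is_derive drho x ((w (rho x) - lambda) / kappa)) /\
      periodic 1 rho /\ RInt rho 0 1 = rs /\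
      (exists x, rho x <> rs) /\ forall x, a <= rho x <= b.
Proof.
  intros HK HW Hw Wa Wb wa wb Wpos WltA WgtB Hrs Wrs.
  destruct (two_phase_competitor W w K a b rs (W rs)) as (q & Hq & Hqp & HqW); auto.
  set (I0 := RInt (fun x => W (rs + primitive q x)) 0 1) in *.
  set (Q := RInt (fun x => q x ^ 2) 0 1).
  assert (HQ : 0 <= Q) by (apply RInt_nonneg; [lra|cont|intros; apply pow2_ge_0]).
  exists (2 * (W rs - I0) / (Q + 1)); split; [apply Rdiv_lt_0_compat; lra|].
  intros kappa [Hk Hk0].
  assert (HE : energy W kappa rs q < W rs).
  { unfold energy; fold Q I0.
    assert (kappa * (Q + 1) < 2 * (W rs - I0)).
    { replace (2 * (W rs - I0)) with (2 * (W rs - I0) / (Q + 1) * (Q + 1))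
        by (field; lra).
      apply Rmult_lt_compat_r; lra. }
    nra. }
  destruct (critical_density_exists W w K kappa rs q HK Hk HW Hw Wpos Hq Hqp HE)
    as (rho & Hrho & Hper & Hncst & Heq).
  assert (Hwc := lipschitz_cont K w HK Hw).
  assert (Hc : forall x, continuous (fun y : R => w (rho y)) x) by cont.
  assert (HP := cont_primitive _ Hc); assert (HPP := cont_primitive _ HP).
  set (h := fun y : R => w (rho y)) in *.
  assert (Hrho1 : forall x, rho x = rs + / kappa * primitive (primitive h) x).
  { intro x; apply Rmult_eq_reg_l with kappa; [|lra].
    rewrite Rmult_plus_distr_l, <- Rmult_assoc, Rinv_r, Rmult_1_l by lra.
    rewrite <- Heq; ring. }
  assert (Dd : forall x, is_derive rho x (/ kappa * primitive h x)).
  { intro x.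
    apply is_derive_ext with (fun x => rs + / kappa * primitive (primitive h) x);
      [intro; now rewrite Hrho1|].
    eapply is_derive_val.
    - apply (is_derive_plus (fun _ => rs) (fun y => / kappa * primitive (primitive h) y)).
      + apply is_derive_const.
      + apply (is_derive_scal (primitive (primitive h))); now apply is_derive_primitive.
    - rewrite mean_primitive by auto; unfold plus, zero; simpl; ring. }
  assert (Ddd : forall x, is_derive (fun x => / kappa * primitive h x) x
                  ((w (rho x) - RInt h 0 1) / kappa)).
  { intro x; eapply is_derive_val.
    - apply (is_derive_scal (primitive h)); now apply is_derive_primitive.
    - unfold h at 1, Rdiv; simpl; ring. }
  assert (Hmean : RInt rho 0 1 = rs).
  { rewrite (RInt_ext rho _ 0 1 (fun x _ => Hrho1 x)).
    rewrite RInt_add, RInt_cst, RInt_mul_l, mean_primitive by (auto; cont).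
    as_real; ring. }
  exists rho, (fun x => / kappa * primitive h x), (RInt h 0 1).
  repeat (split; [now auto|]).
  apply (density_between_wells W w rho _ kappa (RInt h 0 1) a b Hk HW Dd Ddd Hper);
    auto; rewrite Hmean; exact Hrs.
Qed.

(** * Extension of a double well *)

(** The nearest point of [a, b]. *)
Definition clamp (a b r : R) : R := Rmax a (Rmin b r).

Lemma clamp_spec (a b r : R) : a <= b ->
  (r < a /\ clamp a b r = a) \/ (b < r /\ clamp a b r = b) \/
  (a <= r <= b /\ clamp a b r = r).
Proof.
  intros Hab; unfold clamp, Rmax, Rmin.
  destruct (Rle_dec b r) as [H|H].
  - destruct (Rle_dec a b); [|lra].
    destruct (Req_dec b r); [right; right|right; left]; lra.
  - destruct (Rle_dec a r); [right; right|left]; lra.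
Qed.

Lemma lipschitz_of_C1 (f df : R -> R) (a b : R) :
  a <= b ->
  (forall r, a <= r <= b -> is_derive f r (df r) /\ continuous df r) ->
  exists K, 0 < K /\ forall x y, a <= x <= b -> a <= y <= b ->
    Rabs (f y - f x) <= K * Rabs (y - x).
Proof.
  intros Hab Hf.
  destruct (continuity_ab_maj (fun r => Rabs (df r)) a b Hab) as (v & Hv & _).
  { intros r Hr; apply (continuity_pt_comp df Rabs); [|apply Rcontinuity_abs].
    now apply continuity_pt_filterlim, Hf. }
  exists (Rabs (df v) + 1); split; [assert (H := Rabs_pos (df v)); lra|].
  intros x y Hx Hy.
  assert (Hin : forall r, Rmin x y <= r <= Rmax x y -> a <= r <= b).
  { intros r Hr; unfold Rmin, Rmax in Hr; destruct (Rle_dec x y); lra. }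
  destruct (MVT_gen f x y df) as (r & Hr & ->).
  - intros r Hr; apply Hf, Hin; lra.
  - intros r Hr; apply continuity_pt_filterlim.
    apply (ex_derive_continuous f); exists (df r); apply Hf, Hin, Hr.
  - rewrite Rabs_mult; apply Rmult_le_compat_r; [apply Rabs_pos|].
    specialize (Hv r (Hin r Hr)); simpl in Hv; lra.
Qed.

(** A double well given on [a, b] extends to the line, with Lipschitz derivative,
    by a parabola on each side. *)
Lemma double_well_extension (V v dv : R -> R) (a b : R) :
  a < b ->
  (forall r, a <= r <= b ->
     is_derive V r (v r) /\ is_derive v r (dv r) /\ continuous dv r) ->
  V a = 0 -> V b = 0 -> v a = 0 -> v b = 0 ->
  (forall r, a < r < b -> 0 < V r) ->
  exists (W w : R -> R) (K : R),
    0 < K /\ (forall r, is_derive W r (w r)) /\ lipschitz K w /\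
    (forall r, a <= r <= b -> W r = V r /\ w r = v r) /\
    (forall r, 0 <= W r) /\
    (forall r, r < a -> 0 < W r) /\ (forall r, b < r -> 0 < W r).
Proof.
  intros Hab HV Va Vb va vb Vpos.
  destruct (lipschitz_of_C1 v dv a b) as (K & HK & Hlip); [lra|apply HV|].
  set (w := fun r => v (clamp a b r) + (r - clamp a b r)).
  assert (Hw : lipschitz (K + 1) w).
  { intros x y; unfold w.
    assert (Hc : forall r, a <= clamp a b r <= b)
      by (intro r; destruct (clamp_spec a b r) as [|[|]]; lra).
    assert (H1 := Hlip _ _ (Hc x) (Hc y)).
    assert (H2 : Rabs (clamp a b y - clamp a b x) <= Rabs (y - x) /\
                 Rabs ((y - clamp a b y) - (x - clamp a b x)) <= Rabs (y - x)).
    { destruct (clamp_spec a b x) as [[? ->]|[[? ->]|[? ->]]]; try lra;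
      destruct (clamp_spec a b y) as [[? ->]|[[? ->]|[? ->]]]; try lra;
      split; unfold Rabs; repeat destruct Rcase_abs; lra. }
    replace (v (clamp a b y) + (y - clamp a b y) - (v (clamp a b x) + (x - clamp a b x)))
      with ((v (clamp a b y) - v (clamp a b x))
            + ((y - clamp a b y) - (x - clamp a b x))) by ring.
    eapply Rle_trans; [apply Rabs_triang|].
    assert (K * Rabs (clamp a b y - clamp a b x) <= K * Rabs (y - x))
      by (apply Rmult_le_compat_l; lra).
    lra. }
  assert (Hwc := lipschitz_cont (K + 1) w ltac:(lra) Hw).
  assert (w_in : forall r, a <= r <= b -> w r = v r).
  { intros r Hr; unfold w.
    destruct (clamp_spec a b r) as [[? E]|[[? E]|[? E]]]; try lra; rewrite E; ring. }
  set (W := fun r => RInt w a r).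
  assert (W_in : forall r, a <= r <= b -> W r = V r).
  { intros r Hr; unfold W.
    apply is_RInt_unique.
    replace (V r) with (minus (V r) (V a))
      by (rewrite Va; unfold minus, plus, opp; simpl; ring).
    apply (is_RInt_derive V w); auto.
    intros x; rewrite Rmin_left, Rmax_right by lra; intros Hx.
    rewrite w_in by lra; apply HV; lra. }
  assert (Dsq : forall c x, is_derive (fun y => (y - c) ^ 2 / 2) x (x - c))
    by (intros; auto_derive; auto; field).
  assert (Csub : forall c x, continuous (fun y : R => y - c) x) by (intro; cont).
  assert (W_below : forall r, r < a -> W r = (r - a) ^ 2 / 2).
  { intros r Hr; unfold W.
    transitivity (RInt (fun y : R => y - a) a r).
    2: { rewrite (RInt_of_derive _ (fun y : R => y - a) a r (Dsq a)) by auto.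
         as_real; field. }
    apply RInt_ext; intros x; rewrite Rmin_right, Rmax_left by lra; intros Hx; unfold w.
      destruct (clamp_spec a b x) as [[? ->]|[[? ->]|[? ->]]]; try lra. }
  assert (W_above : forall r, b < r -> W r = (r - b) ^ 2 / 2).
  { intros r Hr; unfold W.
    rewrite (RInt_split w a b r) by auto.
    replace (RInt w a b) with 0 by (symmetry; rewrite <- Vb; apply W_in; lra).
    rewrite Rplus_0_l; transitivity (RInt (fun y : R => y - b) b r).
    2: { rewrite (RInt_of_derive _ (fun y : R => y - b) b r (Dsq b)) by auto.
         as_real; field. }
    apply RInt_ext; intros x; rewrite Rmin_left, Rmax_right by lra; intros Hx; unfold w.
      destruct (clamp_spec a b x) as [[? ->]|[[? ->]|[? ->]]]; try lra. }
  assert (B : forall r, r < a -> 0 < W r).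
  { intros r Hr; rewrite W_below by auto.
    assert (0 < (r - a) ^ 2) by (apply pow2_gt_0; lra); lra. }
  assert (A : forall r, b < r -> 0 < W r).
  { intros r Hr; rewrite W_above by auto.
    assert (0 < (r - b) ^ 2) by (apply pow2_gt_0; lra); lra. }
  exists W, w, (K + 1).
  split; [lra|]; split; [now apply is_derive_integral|]; split; [exact Hw|].
  split; [now auto|]; split; [|now split].
  intro r; destruct (Rlt_dec r a); [now apply Rlt_le, B|].
  destruct (Rlt_dec b r); [now apply Rlt_le, A|].
  rewrite W_in by lra.
  destruct (Req_dec r a) as [->|]; [lra|]; destruct (Req_dec r b) as [->|]; [lra|].
  apply Rlt_le, Vpos; lra.
Qed.

(** * Stationary solutions of the Euler-Korteweg equations *)

Lemma wave_speed_0 (f : R -> R) : wave 0 f = fun x _ => f x.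
Proof.
  unfold wave; apply functional_extensionality; intro x.
  apply functional_extensionality; intro t; f_equal; ring.
Qed.

Lemma Dx_stationary (f df : R -> R) :
  (forall x, is_derive f x (df x)) -> Dx (fun x _ => f x) = fun x _ => df x.
Proof.
  intros Hf; unfold Dx; apply functional_extensionality; intro x.
  apply functional_extensionality; intro t.
  exact (is_derive_unique f x _ (Hf x)).
Qed.

Lemma Dt_stationary (f : R -> R) : Dt (fun x _ => f x) = fun _ _ => 0.
Proof.
  unfold Dt; apply functional_extensionality; intro x.
  apply functional_extensionality; intro t; apply Derive_const.
Qed.

Lemma continuity_2d_stationary (f : R -> R) (x t : R) :
  continuous f x -> continuity_2d_pt (fun y _ => f y) x t.
Proof.
  intros Hf eps; apply continuity_pt_filterlim in Hf.
  destruct (proj1 (continuity_pt_locally f x) Hf eps) as [d Hd].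
  exists d; intros u v Hu _; exact (Hd u Hu).
Qed.

Lemma is_derive_div_sqr (m x : R) : 0 < x ->
  is_derive (fun y => m ^ 2 / (2 * y ^ 2)) x (- m ^ 2 / x ^ 3).
Proof.
  intros Hx; auto_derive.
  - apply Rgt_not_eq; assert (0 < x * (x * 1)) by nra; lra.
  - field; lra.
Qed.

(** With zero speed the momentum is constant, and the momentum equation, divided
    by the density, is the derivative of
    [eps * r'' = Psi' r + m ^ 2 / (2 * r ^ 2) - c0]. *)
Lemma stationary_solution (Psi r r1 : R -> R) (m eps c0 : R) :
  C2_on_positive Psi -> 0 < eps -> (forall x, 0 < r x) ->
  (forall x, is_derive r x (r1 x)) ->
  (forall x, is_derive r1 x
     ((Derive Psi (r x) + m ^ 2 / (2 * r x ^ 2) - c0) / eps)) ->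
  euler_korteweg_solution (pressure Psi) eps (wave 0 r) (wave 0 (fun _ => m)).
Proof.
  intros HPsi Heps Hpos Hr Hr1.
  set (r2 := fun x => (Derive Psi (r x) + m ^ 2 / (2 * r x ^ 2) - c0) / eps) in *.
  set (P2 := Derive_n Psi 2).
  set (r3 := fun x => (P2 (r x) - m ^ 2 / r x ^ 3) * r1 x / eps).
  assert (DPsi : forall x, 0 < x -> is_derive Psi x (Derive Psi x))
    by (intros x Hx; apply Derive_correct, HPsi, Hx).
  assert (DPsi2 : forall x, 0 < x -> is_derive (Derive Psi) x (P2 x))
    by (intros x Hx; apply (Derive_correct (Derive Psi)), HPsi, Hx).
  assert (Hr2 : forall x, is_derive r2 x (r3 x)).
  { intro x.
    assert (D1 := is_derive_comp (fun y => Derive Psi y + m ^ 2 / (2 * y ^ 2)) r x _ _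
      (is_derive_plus _ _ _ _ _ (DPsi2 _ (Hpos x)) (is_derive_div_sqr m _ (Hpos x)))
      (Hr x)).
    assert (D2 := is_derive_minus _ _ x _ _ D1 (is_derive_const c0 x)).
    assert (D3 := is_derive_scal _ x (/ eps) _ D2).
    eapply is_derive_ext; [|eapply is_derive_val; [exact D3|]].
    - intro y; unfold r2, minus, plus, opp; simpl; unfold Rdiv; ring.
    - unfold r3, minus, plus, opp, scal, zero; simpl; unfold mult; simpl.
      unfold Rdiv; ring. }
  assert (Hflux : forall x, is_derive (fun y => m ^ 2 / r y) x
                              (- m ^ 2 * r1 x / r x ^ 2)).
  { intro x; assert (Hx := Hpos x); auto_derive.
    - repeat split; [exists (r1 x); apply Hr|lra].
    - change (fun x0 : R => r x0) with r; rewrite (is_derive_unique _ _ _ (Hr x)).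
      field; lra. }
  assert (Hpress : forall x, is_derive (fun y => pressure Psi (r y)) x
                               (r x * P2 (r x) * r1 x)).
  { intro x; assert (Hx := Hpos x).
    assert (D1 := is_derive_mult (fun y => y) (Derive Psi) (r x) _ _
      (is_derive_id (r x)) (DPsi2 _ Hx) ltac:(intros; apply Rmult_comm)).
    assert (D2 := is_derive_minus _ _ _ _ _ D1 (DPsi _ Hx)).
    assert (D3 := is_derive_comp (pressure Psi) r x _ _ D2 (Hr x)).
    eapply is_derive_val; [exact D3|].
    unfold minus, plus, opp, scal, one, mult; simpl; unfold mult; simpl; ring. }
  assert (Cr := continuous_of_derive r r1 Hr).
  assert (Cr1 := continuous_of_derive r1 r2 Hr1).
  assert (Cr2 := continuous_of_derive r2 r3 Hr2).
  assert (Cr3 : forall x, continuous r3 x).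
  { intro x; unfold r3, Rdiv; apply (continuous_mult _ (fun _ => / eps));
      [|apply continuous_const].
    apply (continuous_mult _ r1); [|apply Cr1].
    apply (continuous_minus (fun y => P2 (r y))).
    - apply (continuous_comp r P2); [apply Cr|apply HPsi, Hpos].
    - apply (continuous_mult (fun _ => m ^ 2)); [apply continuous_const|].
      apply continuous_Rinv_comp; [|apply Rgt_not_eq, pow_lt, Hpos].
      apply (ex_derive_continuous (fun y => r y ^ 3)).
      auto_derive; exists (r1 x); apply Hr. }
  assert (Dm : forall x : R, is_derive (fun _ : R => m) x 0)
    by (intro; apply (is_derive_const m)).
  assert (E1 := Dx_stationary r r1 Hr).
  assert (E2 : Dxx (fun x _ => r x) = fun x _ => r2 x)
    by (unfold Dxx; rewrite E1; now apply Dx_stationary).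
  assert (E3 := Dx_stationary r2 r3 Hr2).
  assert (Em := Dx_stationary (fun _ => m) (fun _ => 0) Dm).
  rewrite !wave_speed_0; constructor.
  - intros x t _; apply Hpos.
  - intros x t _; rewrite E2, E1; repeat split.
    + apply (ex_derive_const (r x)).
    + apply (ex_derive_const m).
    + apply (ex_derive_const m).
    + exists (r1 x); apply Hr.
    + exists (r2 x); apply Hr1.
    + exists (r3 x); apply Hr2.
  - intros x t _; rewrite !Dt_stationary, E2, E1, E3, Em.
    repeat split; apply continuity_2d_stationary; auto; apply continuous_const.
  - intros x t _; split.
    + eexists; apply Hflux.
    + eexists; apply Hpress.
  - intros x t _; rewrite Dt_stationary, Em; ring.
  - intros x t _; rewrite Dt_stationary, E2.
    rewrite (Dx_stationary _ _ Hflux), (Dx_stationary _ _ Hpress).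
    rewrite (Dx_stationary (fun y => eps * r2 y) (fun y => eps * r3 y))
      by (intro; apply (is_derive_scal r2), Hr2).
    unfold r3; field; split; [apply Rgt_not_eq, Hpos|lra].
Qed.

(** * Periodic traveling waves *)

Theorem corollary3p4 (Psi : R -> R) (rho_g rho_l : R)
    (m rho_g_m rho_l_m rho_star : R)
    (hPsi : C2_on_positive Psi)
    (hrho : 0 < rho_g < rho_l)
    (hbit : bitangent_below Psi rho_g rho_l)
    (hm : m <> 0)
    (hrho_m : 0 < rho_g_m < rho_l_m)
    (hbit_m : bitangent_below (Psi_m Psi m) rho_g_m rho_l_m)
    (hstar : rho_g_m < rho_star < rho_l_m) :
  exists eps0 : R, 0 < eps0 /\
    forall eps omega : R, 0 < eps -> 0 < omega -> eps / omega ^ 2 < eps0 ->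
      exists (c : R) (rbar mbar : R -> R),
        euler_korteweg_solution (pressure Psi) eps (wave c rbar) (wave c mbar) /\
        periodic omega rbar /\ periodic omega mbar /\
        ~ constant_pair rbar mbar /\
        phase_transition c rbar mbar /\
        (forall t, 0 < t ->
           / omega * RInt (fun x => wave c rbar x t) 0 omega = rho_star).
Proof.
  destruct hbit_m as (alpha & beta & [Fa Da] & [Fb Db] & U & _ & HU & _ & Habove).
  set (a := rho_g_m) in *; set (b := rho_l_m) in *.
  (* The double well: Psi_m minus its bitangent line, and its derivative. *)
  set (V := fun r => Psi_m Psi m r - (alpha + beta * r)).
  set (v := fun r => Derive Psi r + m ^ 2 / (2 * r ^ 2) - beta).
  assert (DF : forall r, 0 < r ->
            is_derive (Psi_m Psi m) r (Derive Psi r + m ^ 2 / (2 * r ^ 2))).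
  { intros r Hr; unfold Psi_m; destruct (hPsi r Hr) as [He _].
    auto_derive; [repeat split; [exact He|lra]|].
    change (fun x : R => Psi x) with Psi; field; lra. }
  assert (va : v a = 0).
  { unfold v; rewrite <- (is_derive_unique _ _ _ Da).
    rewrite (is_derive_unique _ _ _ (DF a ltac:(lra))); ring. }
  assert (vb : v b = 0).
  { unfold v; rewrite <- (is_derive_unique _ _ _ Db).
    rewrite (is_derive_unique _ _ _ (DF b ltac:(lra))); ring. }
  destruct (double_well_extension V v (fun r => Derive_n Psi 2 r - m ^ 2 / r ^ 3) a b)
    as (W & w & K & HK & HW & Hw & Hext & Wpos & WltA & WgtB).
  - lra.
  - intros r Hr; assert (Hr0 : 0 < r) by lra.
    destruct (hPsi r Hr0) as (_ & He & Hc); split; [|split].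
    + assert (D1 : is_derive (fun r => alpha + beta * r) r beta)
        by (auto_derive; auto; ring).
      apply (is_derive_minus _ _ _ _ _ (DF r Hr0) D1).
    + set (P2 := Derive_n Psi 2).
      assert (D0 : is_derive (Derive Psi) r (P2 r))
        by apply (Derive_correct (Derive Psi) r He).
      assert (D1 := is_derive_plus _ _ _ _ _ D0 (is_derive_div_sqr m r Hr0)).
      eapply is_derive_val; [exact (is_derive_minus _ _ _ _ _ D1 (is_derive_const beta r))|].
      unfold minus, plus, opp, zero; simpl; unfold Rdiv; ring.
    + apply (continuous_minus (Derive_n Psi 2)); [exact Hc|].
      apply (ex_derive_continuous (fun r => m ^ 2 / r ^ 3)).
      auto_derive; apply Rgt_not_eq; apply (pow_lt r 3 Hr0).
  - unfold V; rewrite Fa; ring.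
  - unfold V; rewrite Fb; ring.
  - exact va.
  - exact vb.
  - intros r Hr; unfold V.
    assert (H := Habove r (HU r ltac:(lra)) ltac:(lra) ltac:(lra)); lra.
  - assert (Wa : W a = 0)
      by (rewrite (proj1 (Hext a ltac:(lra))); unfold V; rewrite Fa; ring).
    assert (Wb : W b = 0)
      by (rewrite (proj1 (Hext b ltac:(lra))); unfold V; rewrite Fb; ring).
    assert (wa : w a = 0) by (rewrite (proj2 (Hext a ltac:(lra))); exact va).
    assert (wb : w b = 0) by (rewrite (proj2 (Hext b ltac:(lra))); exact vb).
    assert (Wstar : 0 < W rho_star).
    { rewrite (proj1 (Hext rho_star ltac:(lra))); unfold V.
      assert (H := Habove rho_star (HU rho_star ltac:(lra)) ltac:(lra) ltac:(lra)); lra. }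
    destruct (periodic_equilibrium_exists W w K a b rho_star)
      as (kappa0 & Hk0 & Hex); auto.
    exists kappa0; split; [exact Hk0|].
    intros eps omega Heps Homega Hsmall.
    assert (Hk : 0 < eps / omega ^ 2)
      by (apply Rdiv_lt_0_compat; [|apply pow_lt]; lra).
    destruct (Hex (eps / omega ^ 2) (conj Hk Hsmall))
      as (rho & drho & lambda & Hd & Hdd & Hper & Hmean & [x0 Hx0] & Hbound).
    assert (Dscale : forall (f df : R -> R) x, is_derive f (x / omega) (df (x / omega)) ->
              is_derive (fun y => f (y / omega)) x (df (x / omega) / omega)).
    { intros f df x Hf.
      assert (D1 : is_derive (fun y => y / omega) x (/ omega))
        by (auto_derive; auto; unfold Rdiv; ring).
      eapply is_derive_val; [exact (is_derive_comp f _ x _ _ Hf D1)|].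
      unfold scal; simpl; unfold mult; simpl; unfold Rdiv; ring. }
    exists 0, (fun x => rho (x / omega)), (fun _ => m).
    split; [|split; [|split; [|split; [|split]]]].
    + apply (stationary_solution Psi (fun x => rho (x / omega))
               (fun x => drho (x / omega) / omega) m eps (beta + lambda) hPsi Heps).
      * intro x; specialize (Hbound (x / omega)); lra.
      * intro x; apply Dscale, Hd.
      * intro x.
        eapply is_derive_val.
        { apply is_derive_ext with (fun y => / omega * drho (y / omega)).
          - intro y; apply Rmult_comm.
          - apply (is_derive_scal (fun y => drho (y / omega))).
            apply (Dscale drho (fun y => (w (rho y) - lambda) / (eps / omega ^ 2))).
            apply Hdd. }
        cbv beta; rewrite (proj2 (Hext _ (Hbound (x / omega)))); unfold v.
        specialize (Hbound (x / omega)); field; repeat split; lra.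
    + intro x; replace ((x + omega) / omega) with (x / omega + 1) by (field; lra).
      apply Hper.
    + intro x; reflexivity.
    + (* A constant density would be equal to its mean. *)
      intros (k & k' & Hk'); apply Hx0.
      assert (Hcst : forall y, rho y = k).
      { intro y; rewrite <- (proj1 (Hk' (y * omega))); f_equal; field; lra. }
      rewrite <- Hmean, (RInt_ext rho (fun _ => k)) by (intros; apply Hcst).
      rewrite RInt_cst, Hcst; as_real; ring.
    + intro H; apply hm; rewrite <- (H 0); unfold mass_flux; ring.
    + intros t _; rewrite wave_speed_0.
      assert (Hc := continuous_of_derive rho drho Hd).
      rewrite <- Hmean.
      replace (RInt rho 0 1) with (RInt rho (/ omega * 0 + 0) (/ omega * omega + 0))
        by (f_equal; field; lra).
      rewrite <- (RInt_comp_lin rho (/ omega) 0 0 omega) by now apply ex_RInt_cont.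
      rewrite <- RInt_mul_l.
      * apply RInt_ext; intros x _; unfold scal; simpl; unfold mult; simpl.
        f_equal; f_equal; unfold Rdiv; ring.
      * intro x; apply (ex_derive_continuous (fun x => rho (x / omega))).
        eexists; apply Dscale, Hd.
Qed.
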